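(* There is a function $g:\mathbb{Z}_{\ge 1}\to\mathbb{R}_{\ge 0}$ with $g(m)/m\to 0$ as $m\to\infty$ such that the following holds. Let $\mathcal{G}$ be a minor-closed family of graphs which is closed under disjoint union, and let $\mathcal{H}(\mathcal{G})=\{H_1,\dots,H_\ell\}$ ($\ell\ge 1$) be its set of minimal forbidden minors. For $1\le i\le \ell$ let $t_i$ be the number of vertices of $H_i$ and let $x_i$ be the number of edges of a largest matching in the complement of $H_i$; assume $t_1\le t_2\le\cdots\le t_\ell$. Let $\mathcal{P}$ be the lower envelope determined by the pairs $(t_i,x_i)$, $1\le i\le \ell$, as defined in the context; it has finitely many extreme points. Then: (1) for every positive integer $n$, every graph in $\mathcal{G}$ on $n$ vertices has at most $$\max_{(a_j,b_j)} 2^{(\log_2 3)a_j+b_j+g(t_1)}\,n$$ cliques, where the maximum is over all extreme points $(a_j,b_j)$ of $\mathcal{P}$; (2) (tightness) if $t_1$ is sufficiently large (larger than an absolute constant), then for every integer $n\ge \frac43 t_1$ there is a graph in $\mathcal{G}$ on $n$ vertices with at least $$\max_{(a_j,b_j)} 2^{(\log_2 3)a_j+b_j-g(t_1)}\,n$$ cliques, where the maximum is again over all extreme points $(a_j,b_j)$ of $\mathcal{P}$.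
   Context: All graphs are finite and simple, and families of graphs are closed under isomorphism. A clique of a graph is a set of pairwise adjacent vertices; the empty set and single vertices count as cliques. A graph $H$ is a minor of a graph $G$ if $H$ can be obtained (up to isomorphism) from $G$ by contracting edges and deleting vertices and edges. A family $\mathcal G$ is minor-closed if every minor of a member is a member. The minimal forbidden minors of $\mathcal G$ are the graphs (up to isomorphism) not in $\mathcal{G}$ all of whose proper minors are in $\mathcal G$; by the Robertson–Seymour theorem there are finitely many, and a graph belongs to $\mathcal G$ if and only if it has none of them as a minor. Lower envelope. For each $i$, define $f_i:[0,\infty)\to\mathbb{R}$ by $f_i(a)=t_i-2a$ if $0\le a<x_i$ and $f_i(a)=t_i-0.5x_i-1.5a$ if $a\ge x_i$ (a continuous decreasing piecewise linear function with at most one bend, at $a=x_i$). Consider the polygon $\{(a,b)\in\mathbb{R}^2: a\ge 0,\ b\ge 0,\ b\le f_i(a)\text{ for all }1\le i\le \ell\}$. The lower envelope $\mathcal P$ is the part of the boundary of this polygon given by the graph of $\min_i f_i$ in the closed first quadrant, i.e. $\mathcal P=\{(a,b): a\ge 0,\ b=\min_{1\le i\le\ell} f_i(a)\ge 0\}$. It is a piecewise linear curve, all of whose segments have slope $-2$ or $-1.5$, joining a point of the axis $a=0$ to a point of the axis $b=0$. The extreme points of $\mathcal P$ are its two endpoints together with all points at which its slope changes (in either direction, so convex and concave bends are both included). The function $g$ makes explicit the error term $o(t_1)$, which depends only on $t_1$. *)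

(* Defs.v *)
From mathcomp Require Import all_boot all_order all_algebra.
From mathcomp Require Import finmap.
From mathcomp Require Import all_classical all_reals all_analysis.

Set Implicit Arguments.
Unset Strict Implicit.
Unset Printing Implicit Defensive.

Import Order.TTheory GRing.Theory Num.Theory.
Import numFieldNormedType.Exports.

(** * Finite simple graphs *)

Record sgraph := SGraph {
  vertex :> finType;
  edge : rel vertex;
  edge_sym : symmetric edge;
  edge_irrefl : irreflexive edge }.

Definition num_vertices (G : sgraph) : nat := #|vertex G|.

Definition iso (G H : sgraph) : Prop :=
  exists f : G -> H, bijective f /\ forall x y, edge (f x) (f y) = edge x y.

Definition is_clique (G : sgraph) (A : {set G}) : bool :=
  [forall x in A, forall y in A, (x != y) ==> edge x y].

Definition num_cliques (G : sgraph) : nat :=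
  #|[set A : {set G} | is_clique A]%SET|.

Section Complement.
Variable G : sgraph.
Definition compl_rel : rel G := fun x y => (x != y) && ~~ edge x y.
Lemma compl_sym : symmetric compl_rel.
Proof. by move=> x y; rewrite /compl_rel eq_sym edge_sym. Qed.
Lemma compl_irrefl : irreflexive compl_rel.
Proof. by move=> x; rewrite /compl_rel eqxx. Qed.
Definition compl_graph : sgraph := SGraph compl_sym compl_irrefl.
End Complement.

Definition edge_set (G : sgraph) : {set {set G}} :=
  [set e : {set G} | [exists x, exists y, edge x y && (e == [set x; y])]]%SET.

Definition is_matching (G : sgraph) (M : {set {set G}}) : bool :=
  (M \subset edge_set G) && finset.trivIset M.

Definition matching_number (G : sgraph) : nat :=
  \max_(M : {set {set G}} | is_matching M) #|M|.

Section DisjointUnion.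
Variables G H : sgraph.
Definition dunion_rel : rel (G + H)%type := fun p q =>
  match p, q with
  | inl x, inl y => edge x y
  | inr x, inr y => edge x y
  | _, _ => false
  end.
Lemma dunion_sym : symmetric dunion_rel.
Proof. by move=> [x|x] [y|y] //=; rewrite edge_sym. Qed.
Lemma dunion_irrefl : irreflexive dunion_rel.
Proof. by move=> [x|x] /=; rewrite edge_irrefl. Qed.
Definition disjoint_union : sgraph := SGraph dunion_sym dunion_irrefl.
End DisjointUnion.

(** * Minors *)

Section DeleteVertex.
Variables (G : sgraph) (v : G).
Definition del_vertex_rel : rel {x : G | x != v} :=
  fun x y => edge (val x) (val y).
Lemma del_vertex_sym : symmetric del_vertex_rel.
Proof. by move=> x y; rewrite /del_vertex_rel edge_sym. Qed.
Lemma del_vertex_irrefl : irreflexive del_vertex_rel.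
Proof. by move=> x; rewrite /del_vertex_rel edge_irrefl. Qed.
Definition del_vertex : sgraph := SGraph del_vertex_sym del_vertex_irrefl.
End DeleteVertex.

Section DeleteEdge.
Variables (G : sgraph) (u v : G).
Definition del_edge_rel : rel G :=
  fun x y => edge x y && ([set x; y]%SET != [set u; v]%SET).
Lemma del_edge_sym : symmetric del_edge_rel.
Proof. by move=> x y; rewrite /del_edge_rel edge_sym finset.setUC. Qed.
Lemma del_edge_irrefl : irreflexive del_edge_rel.
Proof. by move=> x; rewrite /del_edge_rel edge_irrefl. Qed.
Definition del_edge : sgraph := SGraph del_edge_sym del_edge_irrefl.
End DeleteEdge.

(* The vertex into which [u] and [v] are merged is represented by [u], so the
   contracted graph lives on the vertices other than [v]; loops and parallel
   edges are suppressed. *)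
Section ContractEdge.
Variables (G : sgraph) (u v : G).
Definition merge_vertex (x : G) : G := if x == v then u else x.
Definition contract_rel : rel {x : G | x != v} := fun a b =>
  (a != b) &&
  [exists x, exists y, [&& edge x y, merge_vertex x == val a
                                   & merge_vertex y == val b]].
Lemma contract_sym : symmetric contract_rel.
Proof.
suff S a b : contract_rel a b -> contract_rel b a.
  by move=> a b; apply/idP/idP; apply: S.
case/andP=> ab /existsP[x /existsP[y /and3P[xy xa yb]]].
apply/andP; split; first by rewrite eq_sym.
by apply/existsP; exists y; apply/existsP; exists x; rewrite edge_sym xy xa yb.
Qed.
Lemma contract_irrefl : irreflexive contract_rel.
Proof. by move=> a; rewrite /contract_rel eqxx. Qed.
Definition contract_edge : sgraph := SGraph contract_sym contract_irrefl.
End ContractEdge.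

Inductive minor_step (G : sgraph) : sgraph -> Prop :=
| StepDelVertex (v : G) : minor_step G (del_vertex v)
| StepDelEdge (u v : G) : edge u v -> minor_step G (del_edge u v)
| StepContract (u v : G) : edge u v -> minor_step G (contract_edge u v).

Inductive minor (H : sgraph) : sgraph -> Prop :=
| MinorIso (G : sgraph) : iso H G -> minor H G
| MinorStep (G G' : sgraph) : minor_step G G' -> minor H G' -> minor H G.

Definition proper_minor (H G : sgraph) : Prop := minor H G /\ ~ iso H G.

Definition minor_closed (F : sgraph -> Prop) : Prop :=
  forall G H, F G -> minor H G -> F H.

Definition union_closed (F : sgraph -> Prop) : Prop :=
  forall G H, F G -> F H -> F (disjoint_union G H).

Definition minimal_forbidden (F : sgraph -> Prop) (H : sgraph) : Prop :=
  ~ F H /\ forall K, proper_minor K H -> F K.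

(* [Hs] lists the minimal forbidden minors of [F], one from each isomorphism
   class. *)
Definition lists_minimal_forbidden (F : sgraph -> Prop) (k : nat)
    (Hs : 'I_k -> sgraph) : Prop :=
  [/\ forall i, minimal_forbidden F (Hs i),
      forall H, minimal_forbidden F H -> exists i, iso H (Hs i)
    & forall i j, iso (Hs i) (Hs j) -> i = j].

(** * The lower envelope *)

Local Open Scope classical_set_scope.
Local Open Scope ring_scope.

Section Envelope.
Variable R : realType.

(* Meaningful for [0 <= a] only. *)
Definition bent_line (t x : nat) (a : R) : R :=
  if a < x%:R then t%:R - 2 * a else t%:R - 1 / 2 * x%:R - 3 / 2 * a.

Variables (k : nat) (t x : 'I_k.+1 -> nat).

Definition min_line (a : R) : R :=
  \big[Num.min/bent_line (t ord0) (x ord0) a]_(i < k.+1)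
     bent_line (t i) (x i) a.

Definition lower_envelope : set (R * R) :=
  [set p | [/\ 0 <= p.1, p.2 = min_line p.1 & 0 <= p.2]].

Definition slope_changes_at (a : R) : Prop :=
  exists s s' : R, [/\ s != s',
    \forall a' \near a^'-, min_line a' = min_line a + s * (a' - a)
  & \forall a' \near a^'+, min_line a' = min_line a + s' * (a' - a)].

Definition extreme_points : set (R * R) :=
  [set p | lower_envelope p /\ [\/ p.1 = 0, p.2 = 0 | slope_changes_at p.1]].

Definition log2 (y : R) : R := ln y / ln 2.

(* The maximum of [2 ^ ((log2 3) a + b + e)] over the extreme points [(a, b)];
   the default value 0 is harmless because all these values are positive.
   [fset_set] is the set of extreme points only if there are finitely many. *)
Definition max_extreme (e : R) : R :=
  \big[Num.max/0]_(p <- fset_set extreme_points)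
     2 `^ (log2 3 * p.1 + p.2 + e).

End Envelope.

(* Main.v *)
Require Import Defs.
From mathcomp Require Import all_boot all_order all_algebra.
From mathcomp Require Import finmap.
From mathcomp Require Import all_classical all_reals all_analysis.
From mathcomp Require Import zify ring lra.

Set Implicit Arguments.
Unset Strict Implicit.
Unset Printing Implicit Defensive.

Import Order.TTheory GRing.Theory Num.Theory.
Import numFieldNormedType.Exports.

(** The extremal graphs are disjoint copies of the join of [a] non-adjacent pairs and a
    clique on [b] vertices, which has [3 ^ a * 2 ^ b] cliques. The lines [f_i] say for
    which [(a, b)] this join has [H_i] as a minor. Indeed a model with [s] singleton
    branch sets has at most [(2 * a + b + s) / 2] branch sets, and [s] is at most [a +
    b] plus the number of pairs whose two members are both singleton branch sets; these
    pairs form a matching in the complement of [H_i], so that [2 * t_i <= 3 * a + 2 * b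
    + minn a x_i] ([loose_model_cocktail]). Points strictly below the envelope therefore
    give graphs of the family, and closure under disjoint union gives the factor [n]
    ([num_cliques_lower]).

    For the upper bound a graph of the family is reduced, at the cost of a factor [n * 2 ^
    o(t1)], to a vertex set [W] in which every vertex has few non-neighbours
    ([num_cliques_reduction]). Since the complete graph on [t1] vertices is not in the
    family, Mader's argument bounds the number of edges of its members by [O(t1 ^ 2)]
    times the number of vertices ([num_arcs_bound]), so that every clique lies in the
    closed neighbourhood of a vertex whose degree in what remains is [O(t1 ^ 2)]. Inside
    this neighbourhood one branches on vertices with many non-neighbours
    ([cliques_in_branching]): putting such a vertex in the clique discards a lot, so
    this happens rarely, and sets of more than [8 * (t1 + 1)] vertices always have such
    a vertex, because otherwise they would have a complete minor on [t1] vertices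
    ([dense_complete_minor]).

    In [W] one finds [a] pairs and [c] single vertices that are all adjacent to each other,
    except perhaps inside the pairs, such that [W] has at most [3 ^ a * 2 ^ b] cliques,
    where [b = (|W| + c) / 2 - a] ([cliques_in_bound]). The bound follows from a short
    recursion and is exact when the complement of [W] is a matching. The point [(a, b)]
    lies below the envelope up to [o(t1)]: the vertices outside the pairs and singles
    can be grouped into adjacent pairs without common non-neighbours, which become
    dominating vertices after contraction, and if [(a, b)] were much above the line
    [f_i], the resulting vertices would suffice for [H_i], a matching in the complement
    of [H_i] being sent to the pairs ([not_minor_bound]).

    Finally, [(log2 3) * a + b] is never stationary along the envelope, as its slopes [-2]
    and [-3/2] lie on both sides of [- log2 3]; so its maximum below the envelope is
    attained at an extreme point ([extreme_max]). With [z] about the sixth root of [t1],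
    every loss is at most [2 ^ (857 * z ^ 5)], which fixes the function [g]. *)

(** * Star models of minors *)

Section Models.
Import mathcomp.boot.fintype mathcomp.boot.finset.

Definition num_arcs (G : sgraph) : nat := #|[set p : G * G | edge p.1 p.2]|.

Lemma edge_neq (G : sgraph) (x y : G) : edge x y -> x != y.
Proof. by apply: contraTneq => ->; rewrite edge_irrefl. Qed.

Lemma num_arcs_del_edge (G : sgraph) (u v : G) :
  edge u v -> (num_arcs G = num_arcs (del_edge u v) + 2)%N.
Proof.
move=> uv; have nuv := edge_neq uv.
rewrite /num_arcs.
have -> : [set p : G * G | edge p.1 p.2] =
  [set p : G * G | @edge (del_edge u v) p.1 p.2] :|: [set (u, v); (v, u)].
  apply/setP=> -[x y]; rewrite !inE /= /del_edge_rel /=.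
  have [xy|/negbTE xy] := boolP (edge x y); rewrite /= ?orTb.
    have [E|/eqP nE] := eqVneq [set x; y] [set u; v]; rewrite //=.
    have xuv : x \in [set u; v] by rewrite -E !inE eqxx.
    have yuv : y \in [set u; v] by rewrite -E !inE eqxx orbT.
    have := edge_neq xy.
    move: xuv yuv; rewrite !inE !xpair_eqE.
    by case/orP=> /eqP-> /orP[] /eqP ->; rewrite ?eqxx //= orbT.
  apply/esym/negbTE; apply/negP => /orP[] /eqP [ex ey]; move: xy; rewrite ex ey ?uv //.
  by rewrite edge_sym uv.
rewrite cardsU (_ : _ :&: _ = set0) ?cards0 ?subn0 ?cards2 ?xpair_eqE ?negb_and ?nuv //.
apply/setP=> -[x y]; rewrite !inE /= /del_edge_rel.
apply/negbTE/negP => /andP[/andP[_ /eqP nE]] /orP[] /eqP [ex ey]; apply: nE; rewrite ex ey //.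
by rewrite setUC.
Qed.

(** Once no vertex can be contracted or deleted, only edges remain to be removed. *)
Lemma spanning_subgraph_minor (H G : sgraph) (f : H -> G) :
  bijective f -> (forall x y, edge x y -> edge (f x) (f y)) -> minor H G.
Proof.
have [n] := ubnP (num_arcs G); elim: n G f => // n IH G f leG bf hf.
have [/forallP iso_f|] := boolP [forall x, forall y, edge (f x) (f y) ==> edge x y].
  apply: MinorIso; exists f; split => // x y; apply/idP/idP; last exact: hf.
  by have /forallP/(_ y)/implyP := iso_f x.
rewrite negb_forall => /existsP[x]; rewrite negb_forall => /existsP[y].
rewrite negb_imply => /andP[fxy nxy].
apply: (MinorStep (StepDelEdge fxy)).
apply: (IH _ (f : H -> del_edge (f x) (f y))) => //.
  by have := num_arcs_del_edge fxy; rewrite ltnS in leG; lia.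
move=> a b ab; rewrite /= /del_edge_rel hf //=.
apply: contraNneq nxy => E.
have injf := bij_inj bf.
have fa : f a \in [set f x; f y] by rewrite -E !inE eqxx.
have fb : f b \in [set f x; f y] by rewrite -E !inE eqxx orbT.
have := edge_neq ab.
move: fa fb; rewrite !inE !(inj_eq injf).
by case/orP=> /eqP <- /orP[] /eqP <-; rewrite ?eqxx // edge_sym.
Qed.

(** Minor models whose branch sets are stars with centers [c h]; the vertices that [rho]
    sends to [None] are deleted.  Contracting an edge of a star leaves a star with the same center, so
    that these models can be treated by induction. *)
Definition star_model (H G : sgraph) (c : H -> G) (rho : G -> option H) : Prop :=
  [/\ forall h, rho (c h) = Some h,
      forall x h, rho x = Some h -> x = c h \/ edge (c h) x
    & forall h h', edge h h' ->
        exists x y, [/\ edge x y, rho x = Some h & rho y = Some h']].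

Lemma card_sub_neq (T : finType) (v : T) : (#|{: {x : T | x != v}}|.+1 = #|T|)%N.
Proof.
by rewrite card_sub -(cardC (pred1 v)) card1 add1n.
Qed.

Lemma star_model_minor (H G : sgraph) (c : H -> G) (rho : G -> option H) :
  star_model c rho -> minor H G.
Proof.
have [n] := ubnP #|G|; elim: n G c rho => // n IH G c rho leG [cK star adj].
have [/existsP[v /eqP rv]|] := boolP [exists v, rho v == None].
  apply: (MinorStep (StepDelVertex v)).
  have cv h : c h != v by apply/eqP => E; move: (cK h); rewrite E rv.
  apply: (IH _ (fun h => exist _ (c h) (cv h) : del_vertex v) (fun x => rho (val x))).
    by rewrite /=; have := card_sub_neq v; lia.
  split => /= [h|x h /star [E|xh]|h h' /adj [x [y [xy rx ry]]]].
  - exact: cK.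
  - by left; apply: val_inj.
  - by right.
  - have xv : x != v by apply/eqP => E; rewrite E rv in rx.
    have yv : y != v by apply/eqP => E; rewrite E rv in ry.
    by exists (exist _ x xv), (exist _ y yv).
rewrite negb_exists => /forallP rhoN.
have [/existsP[v /existsP[h /andP[/eqP rv nvc]]]|] :=
    boolP [exists v, exists h, (rho v == Some h) && (v != c h)].
  have uv : edge (c h) v by case: (star _ _ rv) => // E; rewrite E eqxx in nvc.
  apply: (MinorStep (StepContract uv)).
  have cv h' : c h' != v.
    by apply/eqP => E; move: (cK h'); rewrite E rv => -[E']; rewrite -E -E' eqxx in nvc.
  apply: (IH _ (fun h' => exist _ (c h') (cv h') : contract_edge (c h) v) (fun x => rho (val x))).
    by rewrite /=; have := card_sub_neq v; lia.
  have rho_merge x : rho (merge_vertex (c h) v x) = rho x.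
    by rewrite /merge_vertex; case: eqP => // ->; rewrite cK rv.
  have mv x : merge_vertex (c h) v x != v.
    by rewrite /merge_vertex; case: ifP => [_|->//]; exact: cv.
  split => /= [h'|x h' /star [E|xh]|h1 h2 h12].
  - exact: cK.
  - by left; apply: val_inj.
  - right; rewrite /contract_rel -(inj_eq val_inj) /= edge_neq //=.
    apply/existsP; exists (c h'); apply/existsP; exists (val x); rewrite xh /=.
    by rewrite /merge_vertex (negbTE (cv _)) (negbTE (valP x)) !eqxx.
  - have [x [y [xy rx ry]]] := adj _ _ h12.
    exists (exist _ (merge_vertex (c h) v x) (mv x)), (exist _ (merge_vertex (c h) v y) (mv y)); split; rewrite /= ?rho_merge //.
    rewrite /contract_rel -(inj_eq val_inj) /=; apply/andP; split.
      apply/eqP => E; move: (edge_neq h12); suff: Some h1 = Some h2 by case=> ->; rewrite eqxx.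
      by rewrite -rx -ry -(rho_merge x) E rho_merge.
    by apply/existsP; exists x; apply/existsP; exists y; rewrite xy !eqxx.
rewrite negb_exists => /forallP rho_c.
have cE x h : rho x = Some h -> x = c h.
  move=> rx; apply/eqP; have := rho_c x; rewrite negb_exists => /forallP/(_ h).
  by rewrite rx eqxx negbK.
have injc : injective c by move=> h h' E; apply: Some_inj; rewrite -cK E cK.
have cardGH : #|G| <= #|H|.
  rewrite -(card_codom injc); apply/subset_leq_card/subsetP => x _.
  by case E: (rho x) (rhoN x) => [h|] // _; rewrite (cE _ _ E) codom_f.
apply: (spanning_subgraph_minor (inj_card_bij injc cardGH)) => h h' /adj.
by case=> x [y [xy /cE <- /cE <-]].
Qed.

End Models.

(** * Excluding minors *)

Section LooseModels.
Import mathcomp.boot.fintype mathcomp.boot.finset.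

(** What remains of a minor model when the connectivity of the branch sets is
    forgotten.  Only the sizes of the branch sets matter when a minor is to be
    excluded, and these weak models compose directly. *)
Definition loose_model (H G : sgraph) : Prop :=
  exists rho : G -> option H,
    (forall h, exists x, rho x = Some h) /\
    (forall h h', edge h h' ->
       exists x y, [/\ edge x y, rho x = Some h & rho y = Some h']).

Lemma loose_model_trans (K H G : sgraph) :
  loose_model K H -> loose_model H G -> loose_model K G.
Proof.
move=> [f [fs fe]] [g [gs ge]]; exists (fun x => obind f (g x)); split.
  by move=> k; have [h fh] := fs k; have [x gx] := gs h; exists x; rewrite gx.
move=> k k' /fe [h [h' [hh' fh fh']]].
by have [x [y [xy gx gy]]] := ge _ _ hh'; exists x, y; rewrite gx gy.
Qed.

Lemma iso_loose_model (H G : sgraph) : iso H G -> loose_model H G.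
Proof.
move=> [f [[g fK gK] fe]]; exists (fun x => Some (g x)); split.
  by move=> h; exists (f h); rewrite fK.
by move=> h h' hh'; exists (f h), (f h'); rewrite !fK fe.
Qed.

Lemma iso_symm (H G : sgraph) : iso H G -> iso G H.
Proof.
move=> [f [[g fK gK] fe]]; exists g; split; first by exists f.
by move=> x y; rewrite -fe !gK.
Qed.

Lemma minor_step_loose_model (G G' : sgraph) : minor_step G G' -> loose_model G' G.
Proof.
case=> [v|u v uv|u v uv].
- exists (insub : G -> option (del_vertex v)); split.
    by move=> h; exists (val h); exact: valK.
  by move=> h h' hh'; exists (val h), (val h'); rewrite !valK.
- exists (Some : G -> option (del_edge u v)); split; first by move=> h; exists h.
  by move=> h h' /andP[hh' _]; exists h, h'.
- exists (fun x => insub (merge_vertex u v x) : option (contract_edge u v)); split.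
    move=> h; exists (val h); rewrite /merge_vertex (negbTE (valP h)); exact: valK.
  move=> h h' /andP[_ /existsP[x /existsP[y /and3P[xy /eqP mx /eqP my]]]].
  by exists x, y; rewrite mx my !valK.
Qed.

Lemma minor_loose_model (H G : sgraph) : minor H G -> loose_model H G.
Proof.
elim=> [G' /iso_loose_model //|G1 G2 s12 _ HG2].
exact: loose_model_trans HG2 (minor_step_loose_model s12).
Qed.

Lemma iso_card (H G : sgraph) : iso H G -> #|H| = #|G| /\ num_arcs H = num_arcs G.
Proof.
move=> [f [bf fe]]; split; first exact: bij_eq_card bf.
have injf := bij_inj bf.
rewrite /num_arcs -(card_imset (f := fun p : H * H => (f p.1, f p.2))); last first.
  by move=> [a b] [c d] [/injf-> /injf->].
congr #|pred_of_set _|; apply/setP=> -[x y]; rewrite inE /=.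
have [g fK gK] := bf.
apply/imsetP/idP => [[[a b]]|xy]; first by rewrite inE /= => ab [-> ->]; rewrite fe.
by exists (g x, g y); rewrite ?inE /= -?fe !gK.
Qed.

Lemma minor_step_smaller (G G' : sgraph) : minor_step G G' ->
  (#|G'| < #|G|)%N \/ (#|G'| = #|G| /\ num_arcs G' < num_arcs G)%N.
Proof.
case=> [v|u v uv|u v uv].
- by left; rewrite -(card_sub_neq v).
- by right; split => //; rewrite (num_arcs_del_edge uv); lia.
- by left; rewrite -(card_sub_neq v).
Qed.

Lemma minor_smaller (H G : sgraph) : minor H G -> iso H G \/
  ((#|H| < #|G|)%N \/ (#|H| = #|G| /\ num_arcs H < num_arcs G)%N).
Proof.
elim=> [G'|G1 G2 /minor_step_smaller s12 _ HG2]; first by left.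
by right; case: HG2 => [/iso_card [E1 E2]|]; lia.
Qed.

(** Every minor step lowers the number of vertices, or keeps it and lowers the number of
    edges, so that descending through minors outside [F] must stop. *)
Lemma minimal_forbidden_loose_model (F : sgraph -> Prop) (G : sgraph) :
  ~ F G -> exists H, minimal_forbidden F H /\ loose_model H G.
Proof.
have [n] := ubnP #|G|; elim: n G => // n IHn G; rewrite ltnS => leG.
have [m] := ubnP (num_arcs G); elim: m G leG => // m IHm G leG; rewrite ltnS => arcsG nFG.
have [mG|nmG] := pselect (minimal_forbidden F G).
  exists G; split => //; apply: iso_loose_model; exists id.
  by split => //; exists id.
have [K [[KG nKG] nFK]] : exists K, proper_minor K G /\ ~ F K.
  apply: contrapT => nex; apply: nmG; split => // K pK.
  by apply: contrapT => nFK; apply: nex; exists K.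
have [H [mH HK]] : exists H, minimal_forbidden F H /\ loose_model H K.
  case: (minor_smaller KG) => [//|[ltK|[eqK ltK]]].
  - by apply: IHn => //; lia.
  - by apply: IHm => //; lia.
by exists H; split => //; apply: loose_model_trans HK (minor_loose_model KG).
Qed.

Definition complete_rel (n : nat) : rel 'I_n := fun x y => x != y.
Lemma complete_sym n : symmetric (@complete_rel n).
Proof. by move=> x y; rewrite /complete_rel eq_sym. Qed.
Lemma complete_irrefl n : irreflexive (@complete_rel n).
Proof. by move=> x; rewrite /complete_rel eqxx. Qed.
Definition complete_graph (n : nat) : sgraph :=
  SGraph (@complete_sym n) (@complete_irrefl n).

Lemma minor_complete_graph (H : sgraph) : minor H (complete_graph #|H|).
Proof.
apply: (@spanning_subgraph_minor _ _ (enum_rank : H -> complete_graph #|H|)).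
  exact: enum_rank_bij.
by move=> x y /edge_neq xy; rewrite /= /complete_rel (inj_eq enum_rank_inj).
Qed.

End LooseModels.

(** * Counting edges under deletion and contraction *)

Section EdgeBound.
Import mathcomp.boot.fintype mathcomp.boot.finset.

Definition nbr (G : sgraph) (x : G) : {set G} := [set y | edge x y].

Lemma num_arcs_sum (G : sgraph) : num_arcs G = (\sum_(x : G) #|nbr x|)%N.
Proof.
rewrite /num_arcs -sum1_card (eq_bigl (fun p : G * G => predT p.1 && edge p.1 p.2)); last first.
  by move=> p; rewrite inE.
rewrite -(pair_big_dep predT (fun x y => edge x y) (fun _ _ => 1%N)) /=.
by apply: eq_bigr => x _; rewrite sum1_card cardsE.
Qed.

Definition arcs_off (G : sgraph) (v : G) : {set G * G} :=
  [set p | [&& edge p.1 p.2, p.1 != v & p.2 != v]].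

Lemma num_arcs_off (G : sgraph) (v : G) :
  num_arcs G = (#|arcs_off v| + 2 * #|nbr v|)%N.
Proof.
pose out := [set (v, y) | y in nbr v]; pose inn := [set (y, v) | y in nbr v].
have -> : num_arcs G = #|arcs_off v :|: (out :|: inn)|.
  apply: eq_card => -[x y]; rewrite !inE /=.
  apply/idP/orP => [xy|[/and3P[]//|/orP[]/imsetP[z]]].
  - have [ex|nx] := eqVneq x v.
      by right; apply/orP; left; apply/imsetP; exists y; rewrite ?inE -?ex.
    have [ey|ny] := eqVneq y v; last by left; rewrite xy.
    by right; apply/orP; right; apply/imsetP; exists x; rewrite ?inE -?ey // edge_sym.
  - by rewrite inE => vz [-> ->].
  - by rewrite inE edge_sym => vz [-> ->].
have cout : #|out| = #|nbr v| by rewrite card_imset // => a b [].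
have cinn : #|inn| = #|nbr v| by rewrite card_imset // => a b [].
rewrite !cardsU cout cinn.
have -> : out :&: inn = set0.
  apply/setP=> -[x y]; rewrite !inE; apply/negP => /andP[/imsetP[a _ [-> ->]] /imsetP[b vb [E _]]].
  by move: vb; rewrite inE -E edge_irrefl.
have -> : arcs_off v :&: (out :|: inn) = set0.
  apply/setP=> -[x y]; rewrite !inE /=; apply/negP => /andP[/and3P[_ xv yv] /orP[]/imsetP[z _ [ex ey]]].
    by rewrite ex eqxx in xv.
  by rewrite ey eqxx in yv.
rewrite !cards0; lia.
Qed.

Lemma num_arcs_del_vertex (G : sgraph) (v : G) :
  num_arcs (del_vertex v) = #|arcs_off v|.
Proof.
rewrite /num_arcs -(card_imset (f := fun p : del_vertex v * del_vertex v => (val p.1, val p.2))); last first.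
  by move=> [a b] [c d] [/val_inj-> /val_inj->].
apply: eq_card => -[x y]; rewrite inE /=.
apply/imsetP/and3P => [[[a b]]|[xy xv yv]].
  by rewrite inE /= => ab [-> ->]; rewrite (valP a) (valP b).
by exists (exist _ x xv, exist _ y yv); rewrite ?inE.
Qed.

(** An edge [(v, y)] survives as [(u, y)] unless [y] is [u] or already a neighbour of [u]. *)
Lemma num_arcs_contract (G : sgraph) (u v : G) : edge u v ->
  (num_arcs G <= num_arcs (contract_edge u v) + 2 + 2 * #|nbr u :&: nbr v|)%N.
Proof.
move=> uv; have nuv := edge_neq uv; rewrite (num_arcs_off v).
pose N' := nbr v :\: (nbr u :|: [set u]).
have cN' : (#|nbr v| = #|N'| + #|nbr u :&: nbr v| + 1)%N.
  rewrite -(cardsID (nbr u :|: [set u]) (nbr v)) addnC -addnA; congr (_ + _)%N.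
  rewrite setIUr cardsU [nbr v :&: [set u]](_ : _ = [set u]); last first.
    by apply/setIidPr; rewrite sub1set inE edge_sym.
  rewrite (setIC (nbr v)) cards1 (_ : _ :&: [set u] = set0) ?cards0 ?subn0 //.
  by apply/setP=> x; rewrite !inE; case: eqP => [->|]; rewrite ?edge_irrefl ?andbF.
suff : (#|arcs_off v| + 2 * #|N'| <= num_arcs (contract_edge u v))%N by lia.
pose out := [set (u, y) | y in N']; pose inn := [set (y, u) | y in N'].
have cout : #|out| = #|N'| by rewrite card_imset // => a b [].
have cinn : #|inn| = #|N'| by rewrite card_imset // => a b [].
have inN' x : (x \in N') = [&& edge v x, ~~ edge u x & x != u].
  by rewrite !inE negb_or andbC.
have d1 : out :&: inn = set0.
  apply/setP=> -[x y]; rewrite !inE; apply/negP => /andP[/imsetP[a _ [-> ->]] /imsetP[b]].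
  by rewrite inN' => /and3P[_ _ bu] [E _]; rewrite E eqxx in bu.
have d2 : arcs_off v :&: (out :|: inn) = set0.
  apply/setP=> -[x y]; rewrite !inE /=; apply/negP => /andP[/and3P[xy _ _] /orP[]/imsetP[z]].
    by rewrite inN' => /and3P[_ /negP nz _] [ex ey]; apply: nz; rewrite -ex -ey.
  by rewrite inN' => /and3P[_ /negP nz _] [ex ey]; apply: nz; rewrite edge_sym -ex -ey.
have -> : (#|arcs_off v| + 2 * #|N'| = #|arcs_off v :|: (out :|: inn)|)%N.
  by rewrite !cardsU d1 d2 cout cinn !cards0; lia.
rewrite /num_arcs -(card_imset (f := fun p : contract_edge u v * contract_edge u v => (val p.1, val p.2))); last first.
  by move=> [a b] [c d] [/val_inj-> /val_inj->].
apply/subset_leq_card/subsetP => -[x0 y0].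
have lift (a b x y : G) : edge a b -> merge_vertex u v a = x -> merge_vertex u v b = y ->
    x != y -> x != v -> y != v ->
  (x, y) \in [set (val p.1, val p.2) | p in [set p : contract_edge u v * contract_edge u v | edge p.1 p.2]].
  move=> ab ax bY xy xv yv; apply/imsetP.
  exists (exist _ x xv, exist _ y yv); rewrite ?inE //= /contract_rel -(inj_eq val_inj) /= xy /=.
  by apply/existsP; exists a; apply/existsP; exists b; rewrite ab ax bY !eqxx.
rewrite !inE /= => /or3P[/and3P[xy xv yv]|/imsetP[z]|/imsetP[z]].
- by apply: (lift x0 y0) => //; rewrite ?edge_neq // /merge_vertex ?(negbTE xv) ?(negbTE yv).
- rewrite inN' => /and3P[vz nuz zu] [-> ->].
  have zv : z != v by rewrite eq_sym edge_neq.
  by apply: (lift v z); rewrite // /merge_vertex ?eqxx ?(negbTE zv) // eq_sym.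
- rewrite inN' => /and3P[vz nuz zu] [-> ->].
  have zv : z != v by rewrite eq_sym edge_neq.
  by apply: (lift z v); rewrite // /merge_vertex ?eqxx ?(negbTE zv) // edge_sym.
Qed.

End EdgeBound.

(** * A linear bound on the number of edges *)

Section Mader.
Import mathcomp.boot.fintype mathcomp.boot.finset.

(** Each set is as large as the whole family, so choosing one representative after the other
    never gets stuck. *)
Lemma greedy_distinct_representatives (I : eqType) (T : finType) (x0 : T) (s : seq I)
    (A : I -> {set T}) :
  uniq s -> (forall i, i \in s -> size s <= #|A i|)%N ->
  exists f : I -> T, {in s &, injective f} /\ forall i, i \in s -> f i \in A i.
Proof.
elim: s => [|i s IH] /=; first by move=> _ _; exists (fun=> x0).
move=> /andP[nis us] big.
have [f [injf fA]] : exists f : I -> T,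
    {in s &, injective f} /\ forall i, i \in s -> f i \in A i.
  by apply: IH => // j js; apply: ltnW; apply: big; rewrite inE js orbT.
have [y yA yf] : exists2 y, y \in A i & y \notin map f s.
  have : ~~ (A i \subset map f s).
    apply/negP => /subset_leq_card; rewrite leqNgt (leq_ltn_trans (card_size _)) //.
    by rewrite size_map; apply: big; rewrite inE eqxx.
  by case/subsetPn => y; exists y.
exists (fun j => if j == i then y else f j); split; last first.
  move=> j; rewrite inE; case: eqP => [->//|_] /=; exact: fA.
have fy j : j \in s -> f j != y by move=> js; apply: contraNneq yf => <-; apply: map_f.
move=> j k; rewrite !inE; case: (eqVneq j i) => [->|_] /=; case: (eqVneq k i) => [->|_] //=.
- by move=> _ /fy /eqP ne /esym.
- by move=> /fy /eqP ne _.
- exact: injf.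
Qed.

(** The common neighbours provide a private subdivision vertex for each pair [i < j]; it is
    put into the branch set of [T i].  The summand [t] accounts for the branch vertices, which
    must be avoided. *)
Lemma subdivided_complete_minor (G : sgraph) (t : nat) (T : 'I_t -> G) :
  injective T ->
  (forall i j, i != j -> t * t + t <= #|nbr (T i) :&: nbr (T j)|)%N ->
  minor (complete_graph t) G.
Proof.
move=> injT big.
have [t0|t_gt0] := posnP t.
  have no (i : complete_graph t) : False by case: i => m; rewrite t0.
  apply: (@star_model_minor _ _ (fun i => match no i with end) (fun=> None)).
  by split=> // i; case: (no i).
pose s := [seq p : 'I_t * 'I_t <- enum {: 'I_t * 'I_t} | (p.1 < p.2)%N].
pose A (p : 'I_t * 'I_t) := (nbr (T p.1) :&: nbr (T p.2)) :\: [set x | x \in codom T].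
have us : uniq s by rewrite filter_uniq ?enum_uniq.
have ss : (size s <= t * t)%N.
  rewrite size_filter (leq_trans (count_size _ _)) //.
  by rewrite -cardE card_prod !card_ord.
have bigA p : p \in s -> (size s <= #|A p|)%N.
  rewrite mem_filter => /andP[p12 _]; apply: leq_trans ss _.
  have cT : (#|[set x | x \in codom T]| <= t)%N.
    by rewrite cardsE (leq_trans (card_size _)) // size_codom card_ord.
  have := big p.1 p.2; rewrite neq_ltn p12 => /(_ isT).
  rewrite -(cardsID [set x | x \in codom T]) -/(A p).
  have := subset_leq_card (subsetIr (nbr (T p.1) :&: nbr (T p.2)) [set x | x \in codom T]).
  lia.
have [f [injf fA]] := greedy_distinct_representatives (T (Ordinal t_gt0)) us bigA.
pose rho x : option (complete_graph t) := if [pick i | T i == x] is Some i then Some i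
  else if [pick p : 'I_t * 'I_t | (p.1 < p.2)%N && (f p == x)] is Some p then Some p.1 else None.
have memS (p : 'I_t * 'I_t) : (p.1 < p.2)%N -> p \in s.
  by move=> lt; rewrite mem_filter lt mem_enum.
have rhoT i : rho (T i) = Some i.
  by rewrite /rho; case: pickP => [j /eqP /injT ->|/(_ i)]; rewrite ?eqxx.
have rhof (p : 'I_t * 'I_t) : (p.1 < p.2)%N -> rho (f p) = Some p.1.
  move=> lt; rewrite /rho; case: pickP => [j /eqP E|_].
    have := fA _ (memS _ lt); rewrite inE inE => /andP[/negP ncod _].
    by case: ncod; rewrite -E; apply: codom_f.
  case: pickP => [q /andP[lq /eqP E]|/(_ p)]; last by rewrite lt eqxx.
  by rewrite (injf q p (memS _ lq) (memS _ lt) E).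
have fP (p : 'I_t * 'I_t) : (p.1 < p.2)%N -> edge (T p.1) (f p) /\ edge (T p.2) (f p).
  by move=> lt; have := fA _ (memS _ lt); rewrite !inE => /and3P[].
apply: (@star_model_minor _ _ (T : complete_graph t -> G) rho); split=> //.
  move=> x h; rewrite /rho; case: pickP => [j /eqP E [<-]|_]; first by left.
  by case: pickP => [p /andP[lt /eqP <-] [<-]|] //; right; case: (fP _ lt).
move=> h h'; rewrite /= /complete_rel neq_ltn => /orP[] lt.
  exists (f (h, h')), (T h'); rewrite rhoT (rhof (h, h')) //; split=> //.
  by case: (fP (h, h') lt) => _; rewrite edge_sym.
exists (T h), (f (h', h)); rewrite rhoT (rhof (h', h)) //; split=> //.
by case: (fP (h', h) lt).
Qed.

Lemma subset_of_card (T : finType) (X : {set T}) (n : nat) :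
  (n <= #|X|)%N -> exists2 U : {set T}, U \subset X & #|U| = n.
Proof.
move=> le; exists [set x in take n (enum X)].
  by apply/subsetP => x; rewrite inE => /mem_take; rewrite mem_enum.
rewrite cardsE; have /card_uniqP -> : uniq (take n (enum X)) by rewrite take_uniq ?enum_uniq.
by rewrite size_takel // -cardE.
Qed.

Lemma card_bigcup_le (I T : finType) (P : pred I) (A : I -> {set T}) :
  (#|\bigcup_(i | P i) A i| <= \sum_(i | P i) #|A i|)%N.
Proof.
elim/big_ind2: _ => [|m X n Y leX leY|//]; first by rewrite cards0.
by rewrite (leq_trans (leq_of_leqif (leq_card_setU X Y))) ?leq_add.
Qed.

(** Either some neighbourhood already contains [t] elements, and it is
    independent; or all degrees are below [t] and elements can be chosen greedily. *)
Lemma triangle_free_independent (T : finType) (r : rel T) (Q : {set T}) (t : nat) :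
  symmetric r ->
  {in Q & &, forall x y z, r x y -> r x z -> y != z -> ~~ r y z} ->
  (t * t <= #|Q|)%N ->
  exists U : {set T}, [/\ U \subset Q, #|U| = t &
    {in U &, forall x y, x != y -> ~~ r x y}].
Proof.
move=> rC tri big.
have [/existsP[v /andP[vQ dv]]|] := boolP [exists v, (v \in Q) && (t <= #|Q :&: [set y | r v y]|)%N].
  have [U /subsetP UQ cU] := subset_of_card dv.
  exists U; split=> // [|x y /UQ xQ /UQ yQ].
    by apply/subsetP => x /UQ; rewrite inE => /andP[].
  by move: xQ yQ; rewrite !inE => /andP[xQ vx] /andP[yQ vy]; apply: (tri v).
rewrite negb_exists => /forallP small.
suff: forall m, (m <= t)%N -> exists U : {set T}, [/\ U \subset Q, #|U| = m &
    {in U &, forall x y, x != y -> ~~ r x y}] by apply.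
elim=> [|m IH] lemt.
  by exists set0; rewrite sub0set cards0; split=> // x y; rewrite inE.
have [U [UQ cU indU]] := IH (ltnW lemt).
pose bad := U :|: \bigcup_(x in U) (Q :&: [set y | r x y]).
have cbad : (#|bad| < #|Q|)%N.
  apply: leq_trans big; have : (#|\bigcup_(x in U) (Q :&: [set y | r x y])| <= m * t.-1)%N.
    apply: (leq_trans (card_bigcup_le _ _)); rewrite -cU -sum_nat_const.
    apply: leq_sum => x xU; have := small x; rewrite (subsetP UQ _ xU) /=; lia.
  have := leq_of_leqif (leq_card_setU U (\bigcup_(x in U) (Q :&: [set y | r x y]))); rewrite -/bad cU.
  nia.
have [y yQ] : exists2 y, y \in Q & y \notin bad.
  have : ~~ (Q \subset bad) by apply/negP => /subset_leq_card; rewrite leqNgt cbad.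
  by case/subsetPn => y; exists y.
rewrite inE negb_or => /andP[yU /bigcupP nbad].
have ny x : x \in U -> ~~ r x y.
  by move=> xU; apply/negP => rxy; apply: nbad; exists x; rewrite // !inE yQ.
exists (y |: U); split.
- by rewrite subUset sub1set yQ.
- by rewrite cardsU1 yU cU.
- move=> a b; rewrite !inE => /orP[/eqP->|aU] /orP[/eqP->|bU]; rewrite ?eqxx // => ab.
  + by rewrite rC ny.
  + exact: ny.
  + exact: indU.
Qed.

(** In a set of at most [2 * d + 2] vertices with minimum degree at least [d],
    no three vertices can pairwise have few common neighbours, because three neighbourhoods
    would not fit; this provides branch vertices for a subdivision. *)
Lemma dense_half_complete_minor (G : sgraph) (Q : {set G}) (t : nat)
    (d := (3 * (t * t + t) + 3)%N) :
  (d < #|Q| <= 2 * d + 2)%N ->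
  {in Q, forall x, d <= #|nbr x :&: Q|}%N ->
  minor (complete_graph t) G.
Proof.
move=> /andP[Qgt Qle] deg.
pose r (x y : G) := (#|nbr x :&: nbr y :&: Q| < t * t + t)%N.
have [|||U [UQ cU indU]] := @triangle_free_independent _ r Q t.
- by move=> x y; rewrite /r (setIC (nbr x)).
- move=> x y z xQ yQ zQ; rewrite /r => rxy rxz _; apply/negP => ryz.
  have E (a b : G) : nbr a :&: Q :&: (nbr b :&: Q) = nbr a :&: nbr b :&: Q.
    by rewrite setIACA setIid.
  have c1 := cardsUI (nbr x :&: Q) (nbr y :&: Q).
  have c2 := cardsUI (nbr x :&: Q :|: nbr y :&: Q) (nbr z :&: Q).
  rewrite setIUl !E in c2; rewrite E in c1.
  have c3 := leq_of_leqif (leq_card_setU (nbr x :&: nbr z :&: Q) (nbr y :&: nbr z :&: Q)).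
  have c4 : (#|nbr x :&: Q :|: nbr y :&: Q :|: nbr z :&: Q| <= #|Q|)%N.
    by apply: subset_leq_card; rewrite !subUset !subsetIr.
  have := deg _ xQ; have := deg _ yQ; have := deg _ zQ.
  rewrite /d in Qle *; lia.
- rewrite /d in Qgt; lia.
pose T (i : 'I_t) : G := enum_val (cast_ord (esym cU) i).
have TU i : T i \in U by exact: enum_valP.
have injT : injective T by move=> i j /enum_val_inj /cast_ord_inj.
apply: (subdivided_complete_minor injT) => i j ij.
have := indU (T i) (T j) (TU i) (TU j); rewrite (inj_eq injT) => /(_ ij).
by rewrite /r -leqNgt => le; apply: (leq_trans le); apply/subset_leq_card/subsetIl.
Qed.

(** Mader's argument: in a minimal counterexample every edge lies in many triangles, since
    otherwise it could be contracted, and some vertex has degree close to the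
    average; its neighbourhood is then very dense. *)
Lemma num_arcs_bound (F : sgraph -> Prop) (t : nat) (d := (3 * (t * t + t) + 3)%N) :
  minor_closed F -> ~ F (complete_graph t) ->
  forall G, F G -> (num_arcs G <= 2 * d * #|G|)%N.
Proof.
move=> mF nK G; have [n] := ubnP #|G|; elim: n G => // n IHn G; rewrite ltnS => leG.
have [m] := ubnP (num_arcs G); elim: m G leG => // m IHm G leG; rewrite ltnS => leA FG.
have step G' : minor_step G G' -> F G'.
  move=> s; apply: (mF _ _ FG); apply: (MinorStep s); apply: MinorIso.
  by exists id; split=> //; exists id.
rewrite leqNgt; apply/negP => gt.
have [/existsP[u /existsP[w uw]]|noe] := boolP [exists x : G, exists y, edge x y]; last first.
  move: gt; rewrite (_ : num_arcs G = 0%N) //; apply: eq_card0 => -[x y]; rewrite inE /=.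
  by move: noe; rewrite negb_exists => /forallP/(_ x); rewrite negb_exists => /forallP/(_ y)/negbTE.
have arcs_le : (num_arcs G <= 2 * d * #|G| + 2)%N.
  have arcsE := num_arcs_del_edge uw.
  have lt : (num_arcs (del_edge u w) < m)%N by lia.
  have := IHm (del_edge u w) leG lt (step _ (StepDelEdge uw)).
  by rewrite (_ : #|del_edge u w| = #|G|) //; lia.
have [v degv] : exists v : G, (#|nbr v| <= 2 * d + 2)%N.
  apply: contrapT => nex; have big (x : G) : (2 * d + 3 <= #|nbr x|)%N.
    by rewrite leqNgt; apply/negP => lt; apply: nex; exists x; lia.
  have : (#|G| * (2 * d + 3) <= num_arcs G)%N.
    by rewrite num_arcs_sum -sum_nat_const; apply: leq_sum.
  have : (0 < #|G|)%N by apply/card_gt0P; exists u.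
  nia.
have degv_gt : (d < #|nbr v|)%N.
  rewrite ltnNge; apply/negP => le.
  have arcsE := num_arcs_off v; have cardE : #|del_vertex v|.+1 = #|G| := card_sub_neq v.
  have lt : (#|del_vertex v| < n)%N by lia.
  have := IHn _ lt (step _ (StepDelVertex v)); rewrite num_arcs_del_vertex.
  nia.
have common x : x \in nbr v -> (d <= #|nbr x :&: nbr v|)%N.
  rewrite inE => vx; rewrite leqNgt; apply/negP => lt.
  have xv : edge x v by rewrite edge_sym.
  have arcsE := num_arcs_contract xv; have cardE : #|contract_edge x v|.+1 = #|G| := card_sub_neq v.
  have lt' : (#|contract_edge x v| < n)%N by lia.
  have := IHn _ lt' (step _ (StepContract xv)); nia.
apply: nK; apply: (mF _ _ FG); apply: (@dense_half_complete_minor _ (nbr v)) => //.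
by rewrite degv_gt.
Qed.

End Mader.

(** * Pairs that behave like dominating vertices *)

Section Pairs.
Import mathcomp.boot.fintype mathcomp.boot.finset.

Definition nonnbr (G : sgraph) (W : {set G}) (x : G) : {set G} :=
  [set y in W | (y != x) && ~~ edge x y].

(** A branch set of at most two vertices is written as a pair, with equal
    components for a singleton. *)
Definition disjoint_pairs (G : sgraph) (p q : G * G) : bool :=
  [&& p.1 != q.1, p.1 != q.2, p.2 != q.1 & p.2 != q.2].
Definition touching_pairs (G : sgraph) (p q : G * G) : bool :=
  [|| edge p.1 q.1, edge p.1 q.2, edge p.2 q.1 | edge p.2 q.2].
Definition linked (G : sgraph) (p q : G * G) : bool :=
  disjoint_pairs p q && touching_pairs p q.
Definition branch_pair (G : sgraph) (p : G * G) : bool := (p.1 == p.2) || edge p.1 p.2.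

Lemma disjoint_pairs_sym (G : sgraph) : symmetric (@disjoint_pairs G).
Proof.
move=> p q; rewrite /disjoint_pairs !(eq_sym q.1) !(eq_sym q.2).
by rewrite [in RHS](andbCA (p.2 != q.1)).
Qed.

Lemma touching_pairs_sym (G : sgraph) : symmetric (@touching_pairs G).
Proof.
move=> p q; rewrite /touching_pairs !(edge_sym q.1) !(edge_sym q.2).
by rewrite [in RHS](orbCA (edge p.2 q.1)).
Qed.

Lemma nonnbr_sym (G : sgraph) (W : {set G}) (x y : G) :
  x \in W -> y \in nonnbr W x -> x \in nonnbr W y.
Proof. by move=> xW; rewrite !inE xW eq_sym edge_sym => /andP[]. Qed.

Lemma sum_nat_mem (T : finType) (A B : {pred T}) :
  (\sum_(x in A) (x \in B) = #|[predI A & B]|)%N.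
Proof.
rewrite -sum1_card [RHS](eq_bigl (fun x => (x \in A) && (x \in B))); last by move=> x; rewrite inE.
by rewrite big_mkcondr; apply: eq_bigr => x _; case: (x \in B).
Qed.

(** Double counting of the paths [u], [w], [v] in the complement. *)
Lemma card_many_common_nonnbrs (G : sgraph) (W : {set G}) (D q : nat) (u : G) :
  {in W, forall x, #|nonnbr W x| <= D}%N -> u \in W ->
  (#|[set v in W | q < #|nonnbr W u :&: nonnbr W v|]| <= (D * D) %/ q.+1)%N.
Proof.
move=> degD uW; set X := [set v in W | _].
have nW x y : y \in nonnbr W x -> y \in W by rewrite inE => /andP[].
rewrite leq_divRL // -sum_nat_const.
apply: (@leq_trans (\sum_(v in X) \sum_(w in nonnbr W u) (w \in nonnbr W v))%N).
  apply: leq_sum => v; rewrite inE => /andP[_ lt]; apply: (leq_trans lt).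
  by rewrite sum_nat_mem; apply: subset_leq_card; apply/subsetP => w; rewrite !inE.
rewrite exchange_big /=; apply: (@leq_trans (\sum_(w in nonnbr W u) D)%N); last first.
  by rewrite sum_nat_const leq_mul2r degD ?orbT.
apply: leq_sum => w wu; apply: leq_trans (degD w (nW _ _ wu)).
rewrite (eq_bigr (fun v => (v \in [set v | w \in nonnbr W v]) : nat)); last first.
  by move=> v _; rewrite [in RHS]inE.
rewrite sum_nat_mem; apply: subset_leq_card; apply/subsetP => v.
rewrite !inE => /andP[/andP[vW _] /andP[wW /andP[wv nvw]]].
by rewrite vW eq_sym wv edge_sym.
Qed.

(** An edge whose ends have no common non-neighbour, contracted, becomes a
    dominating vertex.  A few common non-neighbours are tolerable: later pairs that
    avoid them are linked to the present one. *)
Lemma linked_pairs_exist (G : sgraph) (W A : {set G}) (D q m : nat) :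
  {in W, forall x, #|nonnbr W x| <= D}%N -> A \subset W ->
  (m * q.+2 + (D * D) %/ q.+1 + D + 1 < #|A|)%N ->
  exists ps : seq (G * G), [/\ size ps = m, pairwise (@linked G) ps &
    forall p, p \in ps -> [/\ p.1 \in A, p.2 \in A, edge p.1 p.2 &
      #|nonnbr W p.1 :&: nonnbr W p.2| <= q]%N].
Proof.
move=> degD AW; elim: m => [|m IH] big; first by exists [::]; split.
have [ps [sps pps psP]] : exists ps : seq (G * G), [/\ size ps = m, pairwise (@linked G) ps &
    forall p, p \in ps -> [/\ p.1 \in A, p.2 \in A, edge p.1 p.2 &
      #|nonnbr W p.1 :&: nonnbr W p.2| <= q]%N].
  by apply: IH; rewrite mulSn in big; lia.
pose Z p := [set p.1; p.2] :|: (nonnbr W p.1 :&: nonnbr W p.2).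
pose bad := \bigcup_(p in ps) Z p.
have cbad : (#|bad| <= m * q.+2)%N.
  apply: (leq_trans (card_bigcup_le _ _)).
  apply: (@leq_trans (\sum_(p in ps) q.+2)%N).
    apply: leq_sum => p pin; apply: leq_trans (leq_of_leqif (leq_card_setU _ _)) _.
    have [_ _ _ le] := psP _ pin; rewrite cards2.
    by apply: (@leq_add _ _ 2 q) le; case: (_ != _).
  by rewrite sum_nat_const leq_mul2r -sps card_size orbT.
have [u uA] : exists2 u, u \in A & u \notin bad.
  have : ~~ (A \subset bad).
    apply/negP => /subset_leq_card le.
    have := leq_trans le cbad; rewrite leqNgt => /negP; apply; apply: leq_trans big.
    by rewrite mulSn ltnS -!addnA (addnCA q.+2) leq_addr.
  by case/subsetPn => u; exists u.
have uW := subsetP AW _ uA.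
pose X := [set v in W | (q < #|nonnbr W u :&: nonnbr W v|)%N].
have cX : (#|X| <= (D * D) %/ q.+1)%N by exact: card_many_common_nonnbrs.
have [v vA] : exists2 v, v \in A & v \notin bad :|: X :|: nonnbr W u :|: [set u].
  have : ~~ (A \subset bad :|: X :|: nonnbr W u :|: [set u]).
    apply/negP => /subset_leq_card.
    have := leq_of_leqif (leq_card_setU (bad :|: X :|: nonnbr W u) [set u]).
    have := leq_of_leqif (leq_card_setU (bad :|: X) (nonnbr W u)).
    have := leq_of_leqif (leq_card_setU bad X).
    have := degD u uW; rewrite cards1 mulSn in big *; lia.
  by case/subsetPn => v; exists v.
have vW := subsetP AW _ vA.
rewrite in_setU in_setU in_setU in_set1 !negb_or -!andbA => /and4P[vbad vX vu nvu] ubad.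
have uv : edge u v by move: vu; rewrite inE vW nvu /= negbK.
exists ((u, v) :: ps); split; first by rewrite /= sps.
- rewrite /= pps andbT; apply/allP => p pin.
  have notin x : x \in W -> x \notin bad -> [&& x != p.1, x != p.2 & edge x p.1 || edge x p.2].
    move=> xW /bigcupP nx; have : x \notin Z p by apply/negP => xZ; apply: nx; exists p.
    rewrite !inE xW /= negb_or negb_or => /andP[/andP[x1 x2]].
    by rewrite x1 x2 /= -negb_or negbK !(edge_sym x).
  have /and3P[u1 u2 /orP up] := notin u uW ubad; have /and3P[v1 v2 _] := notin v vW vbad.
  rewrite /linked /disjoint_pairs /touching_pairs /= u1 u2 v1 v2 /=.
  by case: up => ->; rewrite ?orbT.
- move=> p; rewrite inE => /orP[/eqP->|/psP//]; rewrite /= uA vA uv; split=> //.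
  by move: vX; rewrite inE vW /= -leqNgt.
Qed.

End Pairs.

(** * Embedding a graph with a matching in its complement *)

Section Assignments.
Import mathcomp.boot.fintype mathcomp.boot.finset.

Lemma pair_model_minor (H G : sgraph) (s : H -> G * G) :
  (forall h, branch_pair (s h)) ->
  (forall h h', h != h' -> disjoint_pairs (s h) (s h')) ->
  (forall h h', edge h h' -> touching_pairs (s h) (s h')) ->
  minor H G.
Proof.
move=> valid disj touch.
pose rho x := [pick h | (x == (s h).1) || (x == (s h).2)].
have rhoE x h : (x == (s h).1) || (x == (s h).2) -> rho x = Some h.
  move=> xh; rewrite /rho; case: pickP => [h' xh'|/(_ h)]; last by rewrite xh.
  congr Some; apply/eqP; apply: contraTT xh => /disj /and4P[d1 d2 d3 d4].
  by case/orP: xh' => /eqP->; apply/norP; split.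
apply: (@star_model_minor _ _ (fun h => (s h).1) rho); split.
- by move=> h; apply: rhoE; rewrite eqxx.
- move=> x h; rewrite /rho; case: pickP => // h' xh' [E]; rewrite {h'}E in xh'.
  case/orP: xh' => /eqP->; first by left.
  by case/orP: (valid h) => [/eqP->|]; [left|right].
- move=> h h' /touch /or4P[] e; do 2 eexists; split; try exact: e; apply: rhoE; rewrite eqxx ?orbT //.
Qed.

Definition compatible (H G : sgraph) (x y : H * (G * G)) : bool :=
  disjoint_pairs x.2 y.2 && (edge x.1 y.1 ==> touching_pairs x.2 y.2).

Lemma linked_compatible (H G : sgraph) (x y : H * (G * G)) :
  linked x.2 y.2 -> compatible x y.
Proof. by rewrite /linked /compatible => /andP[-> ->]; rewrite implybT. Qed.

(** The lists [hs] and [ss] encode the map that sends each vertex of [H] to its branch set. *)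
Lemma assignment_minor (H G : sgraph) (hs : seq H) (ss : seq (G * G)) :
  size hs = size ss -> (forall h, h \in hs) -> uniq hs ->
  all (@branch_pair G) ss -> pairwise (@compatible H G) (zip hs ss) -> minor H G.
Proof.
move=> sz cov us valid comp.
have [s0|[h0 h0in]] : (forall h : H, False) \/ exists h : H, True.
    by have [[h _]|n] := pselect (exists h : H, True); [right; exists h|left => h; apply: n; exists h].
  apply: (@pair_model_minor _ _ (fun h => match s0 h with end)) => h; by case: (s0 h).
have [x0 _] : exists x : G * G, True.
  by have := cov h0; case: (ss) sz => [|x ss' _]; [case: (hs)|exists x].
pose s h := nth x0 ss (index h hs).
have lt h : (index h hs < size ss)%N by rewrite -sz index_mem.
have cmp h h' : (index h hs < index h' hs)%N -> compatible (h, s h) (h', s h').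
  have /(pairwiseP (h0, x0)) comp' := comp.
  move=> ltt; have := comp' (index h hs) (index h' hs).
  by rewrite !inE size_zip -sz minnn !index_mem !nth_zip // !nth_index //; apply.
have neq h h' : h != h' -> compatible (h, s h) (h', s h') \/ compatible (h', s h') (h, s h).
  move=> ne; have [l|l|E] := ltngtP (index h hs) (index h' hs); [left|right|]; try exact: cmp.
  by case/eqP: ne; rewrite -(nth_index h0 (cov h)) E nth_index.
apply: (@pair_model_minor _ _ s) => [h|h h' /neq|h h' hh'].
- by apply: (allP valid); rewrite mem_nth.
- case=> /andP[d _]; first exact: d.
  by rewrite disjoint_pairs_sym.
- have := neq _ _ (edge_neq hh').
  rewrite /compatible /= (edge_sym h') hh' /= => -[] /andP[_] //.
  by rewrite touching_pairs_sym.
Qed.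

Definition fully_joined (G : sgraph) (p q : G * G) : bool :=
  [&& edge p.1 q.1, edge p.1 q.2, edge p.2 q.1 & edge p.2 q.2].

Definition ends (T : eqType) (ps : seq (T * T)) : seq T :=
  flatten [seq [:: p.1; p.2] | p <- ps].

Lemma endsP (T : eqType) (ps : seq (T * T)) (x : T) :
  reflect (exists2 p, p \in ps & x = p.1 \/ x = p.2) (x \in ends ps).
Proof.
apply: (iffP flatten_mapP) => [[p pin xp]|[p pin xp]]; exists p => //.
  by move: xp; rewrite !inE => /orP[]/eqP->; [left|right].
by rewrite !inE; case: xp => ->; rewrite eqxx ?orbT.
Qed.

Lemma size_ends (T : eqType) (ps : seq (T * T)) : size (ends ps) = (size ps).*2.
Proof. by elim: ps => //= p ps IH; rewrite -/(ends ps) IH. Qed.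

Lemma all_zip2 (S T : Type) (P : pred T) (s : seq S) (t : seq T) :
  all P t -> all (fun x => P x.2) (zip s t).
Proof. by elim: s t => [|a s IH] [|b t] //= /andP[-> /IH]. Qed.

Definition single (G : sgraph) (x : G) : G * G := (x, x).

Lemma linked_single (G : sgraph) (x y : G) : edge x y -> linked (single x) (single y).
Proof. by move=> xy; rewrite /linked /disjoint_pairs /touching_pairs /= xy edge_neq. Qed.

(** Non-adjacent pairs of vertices of [H] may use the possibly
    non-adjacent pairs [ps]; all other vertices of [H] use the branch sets in [rest]. *)
Lemma matching_embedding_minor (H G : sgraph) (ms : seq (H * H)) (ps rest : seq (G * G)) :
  size ms = size ps ->
  all (fun p => ~~ edge p.1 p.2) ms -> uniq (ends ms) ->
  all (fun p => p.1 != p.2) ps -> pairwise (@fully_joined G) ps ->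
  (forall x s, x \in ends ps -> s \in rest -> linked (single x) s) ->
  all (@branch_pair G) rest -> pairwise (@linked G) rest ->
  (#|H| <= (size ps).*2 + size rest)%N -> minor H G.
Proof.
move=> sz nonadj ums nps pps psrest vrest prest cH.
pose hrest := [seq h <- enum H | h \notin ends ms].
have uhs : uniq (ends ms ++ hrest).
  rewrite cat_uniq ums filter_uniq ?enum_uniq // andbT /=.
  by apply/hasPn => h; rewrite mem_filter => /andP[].
have cov h : h \in ends ms ++ hrest.
  by rewrite mem_cat mem_filter mem_enum; case: (h \in ends ms).
have shs : (size (ends ms) + size hrest = #|H|)%N.
  rewrite -size_cat; have /card_uniqP <- := uhs; apply: eq_card => h.
  by rewrite [LHS]cov.
pose r' := take (size hrest) rest.
have sr' : size r' = size hrest.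
  by rewrite size_takel //; rewrite size_ends sz in shs; lia.
have r'P s : s \in r' -> s \in rest by exact: mem_take.
have sends : size (ends ms) = size (map (@single G) (ends ps)).
  by rewrite size_map !size_ends sz.
apply: (@assignment_minor _ _ (ends ms ++ hrest) (map (@single G) (ends ps) ++ r')) => //.
- by rewrite !size_cat sends sr'.
- rewrite all_cat; apply/andP; split.
    by apply/allP => s /mapP[x _ ->]; rewrite /branch_pair eqxx.
  by apply/allP => s /r'P; apply/allP.
rewrite zip_cat // pairwise_cat; apply/and3P; split.
- apply/allrelP => -[h s] [h' s'] /= zs zs'; apply: linked_compatible => /=.
  have : s \in map (@single G) (ends ps).
    exact: (allP (@all_zip2 _ _ (mem (map (@single G) (ends ps))) _ _ _) _ zs).
  have : s' \in r' by exact: (allP (@all_zip2 _ _ (mem r') _ _ _) _ zs').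
  by move=> /r'P s'r /mapP[x xin ->]; apply: psrest.
- clear -sz nonadj nps pps.
  elim: ms ps sz nonadj nps pps => [|[a b] ms IH] [|[u v] ps] //= [sz] /andP[nab nonadj].
  move=> /andP[nuv nps] /andP[/allP full pps]; rewrite -/(ends ms) -/(ends ps).
  have joined x : x \in [:: u; v] -> all (fun y => linked (single x) (single y)) (ends ps).
    move=> xuv; apply/allP => y /endsP[p /full /and4P[e1 e2 e3 e4] yp].
    apply: linked_single; move: xuv; rewrite !inE => /orP[]/eqP->; by case: yp => ->.
  have cmp h x : x \in [:: u; v] ->
      all (compatible (h, single x)) (zip (ends ms) (map (@single G) (ends ps))).
    move=> xuv; have : all (fun s => linked (single x) s) (map (@single G) (ends ps)).
      by rewrite all_map; apply: joined.
    move=> /(@all_zip2 H _ _ (ends ms)); apply: sub_all => y.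
    exact: (@linked_compatible _ _ (h, single x) y).
  rewrite !cmp ?inE ?eqxx ?orbT // IH // !andbT /compatible /=.
  by rewrite (negbTE nab) /disjoint_pairs /= nuv.
- have : pairwise (@linked G) r'.
    by move: prest; rewrite -{1}(cat_take_drop (size hrest) rest) pairwise_cat => /and3P[].
  clear; elim: hrest r' => [|h hs IH] [|s r'] //= /andP[alls /IH ->]; rewrite andbT.
  have := @all_zip2 H _ _ hs _ alls; apply: sub_all => y.
  exact: (@linked_compatible _ _ (h, s) y).
Qed.

End Assignments.

(** * Counting cliques *)

Section CliqueCount.
Import mathcomp.boot.fintype mathcomp.boot.finset.

Definition cliques_in (G : sgraph) (W : {set G}) : nat :=
  #|[set A : {set G} | is_clique A & A \subset W]|.

Lemma is_cliqueP (G : sgraph) (A : {set G}) :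
  reflect {in A &, forall x y, x != y -> edge x y} (is_clique A).
Proof.
apply: (iffP forall_inP) => [h x y xA yA xy|h x xA].
  by have /forall_inP/(_ y yA)/implyP/(_ xy) := h x xA.
by apply/forall_inP => y yA; apply/implyP; apply: h.
Qed.

Lemma cliques_in_setT (G : sgraph) : cliques_in [set: G] = num_cliques G.
Proof. by apply: eq_card => A; rewrite !inE subsetT andbT. Qed.

Lemma cliques_in0 (G : sgraph) : cliques_in (set0 : {set G}) = 1%N.
Proof.
rewrite /cliques_in (_ : [set _ | _ & _] = [set set0]) ?cards1 //.
apply/setP => A; rewrite !inE subset0; case: eqP => [->|]; rewrite ?andbF // andbT.
by apply/is_cliqueP => x y; rewrite inE.
Qed.

Lemma cliques_in_sub (G : sgraph) (W W' : {set G}) :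
  W \subset W' -> (cliques_in W <= cliques_in W')%N.
Proof.
move=> sW; apply/subset_leq_card/subsetP => A; rewrite !inE => /andP[-> /=].
by move/subset_trans; apply.
Qed.

Lemma cliques_in_split (G : sgraph) (W : {set G}) (v : G) : v \in W ->
  cliques_in W = (cliques_in (W :\ v) + cliques_in (nbr v :&: W))%N.
Proof.
move=> vW; rewrite /cliques_in -(cardsID [set A : {set G} | v \in A]) addnC.
congr (_ + _)%N.
  by apply: eq_card => A; rewrite !inE subsetD1 andbC andbA.
rewrite -[RHS](card_in_imset (f := fun A => v |: A)); last first.
  have nv (A : {set G}) : A \in [set A : {set G} | is_clique A & A \subset nbr v :&: W] -> v \notin A.
    rewrite inE => /andP[_ /subsetP sA]; apply/negP => /sA.
    by rewrite !inE edge_irrefl.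
  by move=> A B /nv vA /nv vB E; rewrite -(setU1K vA) E setU1K.
apply: eq_card => A; rewrite !inE; apply/andP/imsetP.
  case=> /andP[/is_cliqueP cA sA] vA; exists (A :\ v); last by rewrite setD1K.
  rewrite inE; apply/andP; split.
    by apply/is_cliqueP => x y; rewrite !inE => /andP[_ xA] /andP[_ yA]; apply: cA.
  apply/subsetP => x; rewrite !inE => /andP[xv xA].
  by rewrite (cA v x) // 1?eq_sym // (subsetP sA).
case=> B; rewrite inE => /andP[/is_cliqueP cB /subsetP sB] ->; rewrite !inE eqxx; split=> //.
apply/andP; split; last first.
  by apply/subsetP => x; rewrite !inE => /orP[/eqP->//|/sB]; rewrite inE => /andP[].
have vB x : x \in B -> edge v x by move=> /sB; rewrite !inE => /andP[].
apply/is_cliqueP => x y; rewrite !inE => /orP[/eqP->|xB] /orP[/eqP->|yB]; rewrite ?eqxx //.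
- by move=> _; apply: vB.
- by move=> _; rewrite edge_sym; apply: vB.
- exact: cB.
Qed.

Lemma setD1_nbr_nonnbr (G : sgraph) (W : {set G}) (v : G) :
  v \in W -> (W :\ v = (nbr v :&: W) :|: nonnbr W v) /\ [disjoint nbr v :&: W & nonnbr W v].
Proof.
move=> vW; split.
  apply/setP => x; rewrite !inE; case: (x \in W); rewrite ?andbF ?andbT //=.
  by case: eqP => [->|_] /=; rewrite ?edge_irrefl ?orbN.
by rewrite -setI_eq0; apply/eqP/setP => x; rewrite !inE; case: edge; rewrite ?andbF.
Qed.

Lemma card_nbr_nonnbr (G : sgraph) (W : {set G}) (v : G) :
  v \in W -> #|W| = (#|nbr v :&: W| + #|nonnbr W v|).+1.
Proof.
move=> vW; rewrite (cardsD1 v W) vW; have [-> d] := setD1_nbr_nonnbr vW.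
by rewrite cardsU (disjoint_setI0 d) cards0 subn0.
Qed.

(** The vertices listed in [ps] and [cs] are pairwise adjacent, except that the
    two members of a pair of [ps] may be non-adjacent. *)
Definition pairs_and_singles (G : sgraph) (W : {set G}) (ps : seq (G * G)) (cs : seq G) : Prop :=
  [/\ {subset ends ps <= W} /\ {subset cs <= W},
      all (fun p => p.1 != p.2) ps,
      pairwise (@fully_joined G) ps,
      {in ends ps & cs, forall x y, edge x y}
    & pairwise (@edge G) cs].

Lemma pairs_and_singles_sub (G : sgraph) (W W' : {set G}) ps cs :
  W \subset W' -> pairs_and_singles W ps cs -> pairs_and_singles W' ps cs.
Proof.
move=> /subsetP s [[h1 h2] *]; split=> //.
by split=> x; [move/h1/s|move/h2/s].
Qed.

Lemma pairs_and_singles_cons (G : sgraph) (W : {set G}) ps cs (v : G) : v \in W ->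
  pairs_and_singles (nbr v :&: W) ps cs -> pairs_and_singles W ps (v :: cs).
Proof.
move=> vW [[h1 h2] h3 h4 h5 h6]; split=> //=.
- split=> x; first by move/h1; rewrite !inE => /andP[].
  by rewrite inE => /orP[/eqP->//|/h2]; rewrite !inE => /andP[].
- move=> x y xp; rewrite inE => /orP[/eqP->|]; last exact: h5.
  by move: (h1 _ xp); rewrite !inE edge_sym => /andP[].
- by rewrite h6 andbT; apply/allP => x /h2; rewrite !inE => /andP[].
Qed.

Lemma leq_scale (k i j X Y E E' : nat) :
  (j <= k * i -> i * X <= Y * E -> k * E <= E' -> j * X <= Y * E')%N.
Proof.
move=> ji iX kE; apply: leq_trans (leq_mul ji (leqnn X)) _; rewrite -mulnA.
by apply: leq_trans (leq_mul (leqnn k) iX) _; rewrite mulnCA leq_mul2l kE orbT.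
Qed.

(** Adding a vertex [v] with at least two non-neighbours to the singles of
    its neighbourhood multiplies the bound by at least four, and removing [v] divides it by
    the square root of two; since [1 / 4 + 1 / sqrt 2 < 1], one of the two smaller solutions is
    good enough.  When every vertex has at most one non-neighbour, the bound is an equality. *)
Lemma cliques_in_bound (G : sgraph) (W : {set G}) :
  exists ps cs, [/\ pairs_and_singles W ps cs, 2 * size ps + size cs <= #|W| &
    cliques_in W ^ 2 * 4 ^ size ps <= 9 ^ size ps * 2 ^ (size cs + #|W|)]%N.
Proof.
have [n] := ubnP #|W|; elim: n W => // n IH W; rewrite ltnS => leW.
have [/existsP[v /andP[vW d2]]|] := boolP [exists v, (v \in W) && (2 <= #|nonnbr W v|)%N].
  have cW := card_nbr_nonnbr vW; have cW1 := cardsD1 v W; rewrite vW in cW1.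
  have [|ps1 [cs1 [P1 L1 B1]]] := IH (W :\ v); first by lia.
  have [|ps2 [cs2 [P2 L2 B2]]] := IH (nbr v :&: W); first by lia.
  rewrite (cliques_in_split vW).
  set i1 := cliques_in (W :\ v) in B1 *; set i2 := cliques_in (nbr v :&: W) in B2 *.
  have [le|lt] := leqP (8 * i2 ^ 2) (i1 ^ 2)%N.
    exists ps1, cs1; split; [by apply: pairs_and_singles_sub P1; apply: subD1set|lia|].
    have : ((i1 + i2) ^ 2 <= 2 * i1 ^ 2)%N.
      have : (5 * i2 <= 2 * i1)%N by nia.
      nia.
    have -> : (size cs1 + #|W| = (size cs1 + #|W :\ v|).+1)%N by lia.
    by move=> le2; apply: leq_scale le2 B1 _; rewrite expnS.
  exists ps2, (v :: cs2); split; [exact: pairs_and_singles_cons|rewrite /=; lia|].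
  have : ((i1 + i2) ^ 2 <= 16 * i2 ^ 2)%N.
    have : (i1 <= 3 * i2)%N by nia.
    nia.
  have le : (2 ^ (size cs2 + #|nbr v :&: W|) * 16 <= 2 ^ (size (v :: cs2) + #|W|))%N.
    by rewrite -[16%N]/(2 ^ 4)%N -expnD leq_exp2l //=; lia.
  by move=> le16; apply: leq_scale le16 B2 _; rewrite mulnC.
rewrite negb_exists => /forallP small.
have [->|[v vW]] := set_0Vmem W.
  exists [::], [::]; split; [|by []|by rewrite cliques_in0 cards0].
  by split=> //.
have cW := card_nbr_nonnbr vW.
have le1 u : u \in W -> (#|nonnbr W u| <= 1)%N.
  by move=> uW; have := small u; rewrite uW /= -ltnNge.
have := le1 v vW; rewrite leq_eqVlt ltnS leqn0 cards_eq0 => /orP[/cards1P[w wE]|/eqP v0].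
  have : w \in nonnbr W v by rewrite wE inE.
  have [sD _] := setD1_nbr_nonnbr vW; rewrite wE in sD cW; rewrite cards1 in cW.
  set W' := nbr v :&: W in sD cW.
  move=> wn; have wW : w \in W by move: wn; rewrite inE => /andP[].
  have wv : w != v by move: wn; rewrite inE => /and3P[].
  have nwE : nonnbr W w = [set v].
    apply/eqP; rewrite eq_sym eqEcard cards1 le1 // andbT sub1set.
    exact: nonnbr_sym wn.
  have wDv : w \in W :\ v by rewrite !inE wv.
  have E1 : (W :\ v) :\ w = W'.
    apply/setP => x; rewrite sD !inE; have [->|] := eqVneq x w; rewrite /= ?orbF //.
    by have := wn; rewrite /W' !inE => /and3P[_ _ /negbTE->].
  have E2 : nbr w :&: (W :\ v) = W'.
    apply/setP => x; rewrite -E1 !inE; have := congr1 (fun X : {set G} => x \in X) nwE; rewrite !inE.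
    have [->|xw] := eqVneq x w; rewrite ?edge_irrefl //=.
    by have [->|xv] := eqVneq x v; rewrite /= ?andbF //; case: (x \in W); case: edge.
  have [|ps [cs [P L B]]] := IH W'; first by lia.
  exists ((v, w) :: ps), cs; split; [|rewrite /=; lia|]; last first.
    rewrite (cliques_in_split vW) (cliques_in_split wDv) E1 E2 -/W' /= cW.
    set i := cliques_in W' in B *.
    have -> : (size cs + (#|W'| + 1).+1 = (size cs + #|W'|).+2)%N by lia.
    rewrite !expnS; move: B; rewrite -!mulnn; set E := (2 ^ _)%N; set X := (4 ^ _)%N; set Y := (9 ^ _)%N.
    nia.
  have adjv x : x \in W' -> edge v x by rewrite !inE => /andP[].
  have adjw x : x \in W' -> edge w x by rewrite -E2 !inE => /andP[].
  have W'W x : x \in W' -> x \in W by rewrite !inE => /andP[].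
  case: P => [[h1 h2] h3 h4 h5 h6]; split=> //=.
  - split=> x; rewrite ?inE; last by move/h2/W'W.
    by rewrite -/(ends ps) => /or3P[/eqP->//|/eqP->//|/h1/W'W].
  - by rewrite eq_sym wv.
  - rewrite h4 andbT; apply/allP => p pin; have m1 : p.1 \in ends ps.
      by apply/endsP; exists p => //; left.
    have m2 : p.2 \in ends ps by apply/endsP; exists p => //; right.
    by rewrite /fully_joined /= !adjv ?adjw ?h1.
  - move=> x y; rewrite !inE -/(ends ps) => /or3P[/eqP->|/eqP->|xp] yc.
    + by apply/adjv/h2.
    + by apply/adjw/h2.
    + exact: h5.
have [sD _] := setD1_nbr_nonnbr vW; rewrite v0 cards0 in cW; rewrite v0 setU0 in sD.
have [|ps [cs [P L B]]] := IH (nbr v :&: W); first by lia.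
exists ps, (v :: cs); split; [exact: pairs_and_singles_cons|rewrite /=; lia|].
rewrite (cliques_in_split vW) sD cW /=.
set i := cliques_in _ in B *.
have -> : ((size cs).+1 + (#|nbr v :&: W| + 0).+1 = (size cs + #|nbr v :&: W|).+2)%N by lia.
rewrite !expnS; move: B; rewrite -!mulnn; set E := (2 ^ _)%N; set X := (4 ^ _)%N; set Y := (9 ^ _)%N.
nia.
Qed.

(** A clique is determined by the vertices with many non-neighbours picked along
    the way, of which there are at most [#|W| %/ D.+1], and by its trace on the good set reached
    at the end. *)
Lemma cliques_in_branching (G : sgraph) (good : {set G} -> Prop) (D M : nat) (W : {set G}) :
  (forall W' : {set G}, W' \subset W -> good W' \/
     exists2 v, v \in W' & D <= #|nonnbr W' v|)%N ->
  (forall W' : {set G}, W' \subset W -> good W' -> cliques_in W' <= M)%N ->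
  (cliques_in W <= #|W|.+1 ^ (#|W| %/ D.+1) * M)%N.
Proof.
have [n] := ubnP #|W|; elim: n W => // n IH W; rewrite ltnS => leW br gM.
case: (br _ (subxx W)) => [gW|[v vW deg]].
  by apply: leq_trans (gM _ (subxx W) gW) _; rewrite leq_pmull // expn_gt0.
have cW := card_nbr_nonnbr vW; have cW1 := cardsD1 v W; rewrite vW in cW1.
have s1 : W :\ v \subset W := subD1set W v.
have s2 : nbr v :&: W \subset W := subsetIr _ _.
have l1 : (#|W :\ v| < n)%N by lia.
have l2 : (#|nbr v :&: W| < n)%N by lia.
have := IH _ l1 (fun W' h => br W' (subset_trans h s1)) (fun W' h => gM W' (subset_trans h s1)).
have := IH _ l2 (fun W' h => br W' (subset_trans h s2)) (fun W' h => gM W' (subset_trans h s2)).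
rewrite (cliques_in_split vW) => b2 b1.
have k_gt0 : (0 < #|W| %/ D.+1)%N by rewrite divn_gt0 //; lia.
have b1' : (cliques_in (W :\ v) <= #|W| ^ (#|W| %/ D.+1) * M)%N.
  apply: (leq_trans b1); rewrite leq_mul2r -[#|W :\ v|.+1]/(1 + _)%N -cW1.
  by apply/orP; right; rewrite leq_pexp2l ?leq_div2r //; lia.
have [r rE] : exists r, #|W| = (r + D.+1)%N by exists (#|W| - D.+1)%N; lia.
have kE : (#|W| %/ D.+1 = (r %/ D.+1).+1)%N by rewrite rE divnDr // divnn addn1.
have b2' : (cliques_in (nbr v :&: W) <= #|W| ^ (r %/ D.+1) * M)%N.
  apply: (leq_trans b2); rewrite leq_mul2r; apply/orP; right.
  apply: (@leq_trans (#|W| ^ (#|nbr v :&: W| %/ D.+1))%N).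
    by case: (_ %/ _)%N => // e; rewrite leq_exp2r //; lia.
  by rewrite leq_pexp2l ?leq_div2r //; lia.
move: b1' b2'; rewrite kE => b1' b2'.
apply: (leq_trans (leq_add b1' b2')); rewrite -mulnDl leq_mul2r; apply/orP; right.
rewrite expnS -[X in (_ + X)%N]mul1n -mulnDl addn1 expnS leq_mul2l /=.
by case: (r %/ _)%N => // e; rewrite leq_exp2r.
Qed.

End CliqueCount.

(** * The combinatorial upper bound *)

Section UpperBound.
Import mathcomp.boot.fintype mathcomp.boot.finset.

Lemma matching_pairs (H : sgraph) (M : {set {set H}}) :
  @is_matching (compl_graph H) M ->
  exists ms : seq (H * H), [/\ size ms = #|M|,
    all (fun p => ~~ edge p.1 p.2) ms & uniq (ends ms)].
Proof.
move=> /andP[sM tM].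
have eM (A : {set H}) : A \in M -> exists x y, [/\ x != y, ~~ edge x y & A = [set x; y]].
  move=> /(subsetP sM); rewrite inE => /existsP[x /existsP[y /andP[/andP[xy nxy] /eqP ->]]].
  by exists x, y.
have : exists ms : seq (H * H), [/\ size ms = size (enum M),
    all (fun p => ~~ edge p.1 p.2) ms, uniq (ends ms) &
    forall x, x \in ends ms -> exists2 A, A \in enum M & x \in A].
  have sub : {subset enum M <= M} by move=> A; rewrite mem_enum.
  elim: (enum M) (enum_uniq M) sub => [|A s IH] /=.
    by move=> _ _; exists [::]; split.
  move=> /andP[nAs us] sub.
  have [|ms [sz na ue eA]] := IH us; first by move=> B Bs; apply: sub; rewrite inE Bs orbT.
  have AM : A \in M by apply: sub; rewrite inE eqxx.
  have [x [y [xy nxy AE]]] := eM A AM.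
  have nin w : w \in A -> w \notin ends ms.
    move=> wA; apply/negP => /eA [B Bs wB].
    have BM : B \in M by apply: sub; rewrite inE Bs orbT.
    have AB : A != B by apply: contraNneq nAs => ->.
    have := trivIsetP tM A B AM BM AB; rewrite -setI_eq0 => /eqP/setP/(_ w).
    by rewrite !inE wA wB.
  exists ((x, y) :: ms); split; rewrite /= -?/(ends ms).
  - by rewrite sz.
  - by rewrite nxy.
  - by rewrite inE negb_or xy ue !nin // AE !inE eqxx ?orbT.
  - move=> w; rewrite !inE => /or3P[/eqP->|/eqP->|/eA[B Bs wB]].
    + by exists A; rewrite ?inE ?eqxx // AE !inE eqxx.
    + by exists A; rewrite ?inE ?eqxx // AE !inE eqxx orbT.
    + by exists B; rewrite ?inE ?Bs ?orbT.
by case=> ms [sz na ue _]; exists ms; rewrite sz -cardE.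
Qed.

Lemma matching_number_pairs (H : sgraph) (n : nat) :
  (n <= matching_number (compl_graph H))%N ->
  exists ms : seq (H * H), [/\ size ms = n,
    all (fun p => ~~ edge p.1 p.2) ms & uniq (ends ms)].
Proof.
have [|M mM E] := @eq_bigmax_cond {set {set H}} (@is_matching (compl_graph H)) (fun M => #|M|).
  apply/card_gt0P; exists set0; rewrite unfold_in /is_matching sub0set /=.
  by rewrite /trivIset /cover !big_set0 cards0.
have -> : matching_number (compl_graph H) = #|M| := E.
have [ms [sz na ue]] := matching_pairs mM; move=> len; exists (take n ms).
rewrite size_takel ?sz //; split=> //.
  by move: na; rewrite -{1}(cat_take_drop n ms) all_cat => /andP[].
by move: ue; rewrite -{1}(cat_take_drop n ms) /ends map_cat flatten_cat cat_uniq => /andP[].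
Qed.

(** Of the pairs, [minn (size ps) x] represent two vertices of [H] each, where [x] is the size of the
    matching in the complement of [H], and the others only one.  All vertices
    of [W] that are not used in this way are grouped into adjacent pairs without common
    non-neighbour, except for at most [D * D + D + 3] of them. *)
Lemma not_minor_bound (H G : sgraph) (W : {set G}) (D : nat) ps cs :
  {in W, forall x, #|nonnbr W x| <= D}%N -> pairs_and_singles W ps cs -> ~ minor H G ->
  (#|W| + size ps + size cs + minn (size ps) (matching_number (compl_graph H))
     <= 2 * #|H| + (D * D + D + 3))%N.
Proof.
move=> degD [[psW csW] nps pps pscs pcs] nHG.
rewrite leqNgt; apply/negP => lt; apply: nHG.
set k := minn _ _ in lt.
have [ms [sms na ue]] := matching_number_pairs (geq_minr (size ps) _ : (k <= _)%N).
have kps : (k <= size ps)%N := geq_minl _ _.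
pose ps1 := take k ps; pose ps2 := drop k ps.
have psE : ps1 ++ ps2 = ps := cat_take_drop k ps.
have sps1 : size ps1 = k by rewrite size_takel.
have sps2 : (size ps2 = size ps - k)%N by rewrite size_drop.
pose U := cs ++ map fst ps2; pose used := ends ps1 ++ U.
have endsE : ends ps = ends ps1 ++ ends ps2 by rewrite -{1}psE /ends map_cat flatten_cat.
have fst_ends p : p \in ps2 -> p.1 \in ends ps2 by move=> pin; apply/endsP; exists p => //; left.
have usedW x : x \in used -> x \in W.
  rewrite !mem_cat => /or3P[x1|/csW//|/mapP[p /fst_ends pe ->]]; apply: psW.
    by rewrite endsE mem_cat x1.
  by rewrite endsE mem_cat pe orbT.
pose A := W :\: [set x in used].
have sused : size used = (size ps + k + size cs)%N.
  rewrite /used /U !size_cat size_ends size_map sps1 sps2.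
  have aux a b c : (a <= b -> a.*2 + (c + (b - a)) = b + a + c)%N by lia.
  exact: aux.
have cA : (#|W| <= #|A| + size used)%N.
  rewrite -(cardsID [set x in used] W) addnC leq_add2l.
  apply: leq_trans (card_size used); rewrite -(cardsE (mem used)).
  by apply: subset_leq_card; apply: subsetIr.
have [Rp [sRp pRp RpP]] : exists Rp : seq (G * G), [/\ (#|A| <= 2 * size Rp + (D * D + D + 3))%N,
    pairwise (@linked G) Rp &
    forall p, p \in Rp -> [/\ p.1 \in A, p.2 \in A, edge p.1 p.2 &
      #|nonnbr W p.1 :&: nonnbr W p.2| <= 0]%N].
  have [le|gt] := leqP #|A| (D * D + D + 2)%N; first by exists [::]; split; rewrite //=; lia.
  have [|Rp [sRp pRp RpP]] := @linked_pairs_exist _ W A D 0 ((#|A| - (D * D + D + 2))./2) degD (subsetDl _ _).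
    by rewrite divn1; lia.
  by exists Rp; split => //; rewrite sRp; lia.
have usedRp x p : x \in used -> p \in Rp -> linked (single x) p.
  move=> xu /RpP [p1 p2 _]; rewrite leqn0 cards_eq0 => /eqP/setP/(_ x).
  move: p1 p2; rewrite !inE => /andP[n1 _] /andP[n2 _].
  have x1 : x != p.1 by apply: contraNneq n1 => <-.
  have x2 : x != p.2 by apply: contraNneq n2 => <-.
  rewrite (usedW _ xu) x1 x2 /= => /negbT; rewrite -negb_or negbK !(edge_sym _ x) => /orP e.
  by rewrite /linked /disjoint_pairs /touching_pairs /= x1 x2; case: e => ->; rewrite ?orbT.
have [pp12 pp1 pp2] : [/\ allrel (@fully_joined G) ps1 ps2, pairwise (@fully_joined G) ps1
    & pairwise (@fully_joined G) ps2].
  by move: pps; rewrite -{1}psE pairwise_cat => /and3P[].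
have pU : pairwise (@edge G) U.
  rewrite pairwise_cat pcs /=; apply/andP; split.
    apply/allrelP => x y xc /mapP[p /fst_ends pe ->]; rewrite edge_sym.
    by apply: pscs => //; rewrite endsE mem_cat pe orbT.
  by rewrite pairwise_map; apply: sub_pairwise pp2 => p q /and4P[].
apply: (@matching_embedding_minor _ _ ms ps1 (map (@single G) U ++ Rp)) => //.
- by rewrite sms sps1.
- by move: nps; rewrite -{1}psE all_cat => /andP[].
- move=> x s xe; rewrite mem_cat => /orP[/mapP[y yU ->]|]; last first.
    by apply: usedRp; rewrite mem_cat xe.
  apply: linked_single; move: yU; rewrite mem_cat => /orP[yc|/mapP[p pin ->]].
    by apply: pscs => //; rewrite endsE mem_cat xe.
  have /endsP[q qin xq] := xe; have /and4P[e1 _ e3 _] := allrelP pp12 q p qin pin.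
  by case: xq => ->.
- rewrite all_cat; apply/andP; split.
    by apply/allP => s /mapP[x _ ->]; rewrite /branch_pair eqxx.
  by apply/allP => p /RpP [_ _ e _]; rewrite /branch_pair e orbT.
- rewrite pairwise_cat pRp andbT; apply/andP; split.
    apply/allrelP => s p /mapP[x xU ->]; apply: usedRp.
    by rewrite mem_cat xU orbT.
  by rewrite pairwise_map; apply: sub_pairwise pU => x y; exact: linked_single.
- rewrite size_cat size_map sps1; rewrite /U size_cat size_map sps2.
  lia.
Qed.

(** The pairs may have up to [#|W| %/ (4 * t.+1)] common non-neighbours, so that [t] of them
    can be chosen one after the other. *)
Lemma dense_complete_minor (G : sgraph) (W : {set G}) (t r : nat) :
  (16 * t.+1 <= r * r)%N -> (8 * t.+1 < #|W|)%N ->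
  {in W, forall x, #|nonnbr W x| <= #|W| %/ r}%N ->
  minor (complete_graph t) G.
Proof.
move=> r2 bigW deg.
pose q := (#|W| %/ (4 * t.+1))%N.
have cond : (t * q.+2 + ((#|W| %/ r) * (#|W| %/ r)) %/ q.+1 + #|W| %/ r + 1 < #|W|)%N.
  have q1 : (4 * t.+1 * q <= #|W|)%N by rewrite mulnC leq_trunc_div.
  have q2 : (#|W| < 4 * t.+1 * q.+1)%N by rewrite mulnC ltn_ceil.
  have d1 : (r * (#|W| %/ r) <= #|W|)%N by rewrite mulnC leq_trunc_div.
  have r4 : (4 <= r)%N by nia.
  move: d1; set D := (#|W| %/ r)%N => d1.
  have x1 : ((D * D) %/ q.+1 * q.+1 <= D * D)%N := leq_trunc_div _ _.
  move: x1; set X := ((D * D) %/ q.+1)%N => x1.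
  move: q1 q2 bigW d1; set N := #|W| => q1 q2 bigW d1.
  have d4 : (4 * D <= N)%N by apply: leq_trans d1; rewrite leq_mul2r r4 orbT.
  have dd : (16 * t.+1 * (D * D) <= N * N)%N.
    apply: (@leq_trans (r * r * (D * D))%N); first by rewrite leq_mul2r r2 orbT.
    by rewrite mulnACA leq_mul.
  have dd2 : (4 * (D * D) < N * q.+1)%N.
    rewrite -(ltn_pmul2l (m := 4 * t.+1)) //.
    have lt : (N * N < N * (4 * t.+1 * q.+1))%N by rewrite ltn_pmul2l //; lia.
    by apply: leq_trans (leq_trans lt _); [rewrite ltnS; lia|rewrite mulnCA].
  have x4 : (4 * X < N)%N.
    rewrite -(ltn_pmul2r (m := q.+1)) //; apply: leq_ltn_trans dd2.
    by rewrite -mulnA leq_mul2l x1 orbT.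
  nia.
have [ps [sz pps psP]] := linked_pairs_exist deg (subxx W) cond.
apply: (@matching_embedding_minor _ _ [::] [::] ps) => //.
  by apply/allP => p /psP[_ _ e _]; rewrite /branch_pair e orbT.
by rewrite /= card_ord sz.
Qed.

(** Each round halves the size of the sets at the cost of at most [2 * r] choices of a vertex. *)
Lemma cliques_in_halving (G : sgraph) (t r M : nat) :
  (16 * t.+1 <= r * r)%N -> ~ minor (complete_graph t) G ->
  (forall W : {set G}, #|W| <= 8 * t.+1 -> cliques_in W <= M)%N ->
  forall j (W : {set G}), (#|W| <= 2 ^ j * (8 * t.+1))%N ->
  (cliques_in W <= (2 ^ j * (8 * t.+1)).+1 ^ (2 * r * j) * M)%N.
Proof.
move=> r2 nK smallM; elim=> [|j IH] W cW.
  by rewrite muln0 expn0 mul1n; apply: smallM; rewrite expn0 mul1n in cW.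
set N := (2 ^ j * (8 * t.+1))%N in IH.
have N2 : (2 ^ j.+1 * (8 * t.+1) = 2 * N)%N by rewrite expnS -mulnA.
rewrite N2 in cW *.
have r_gt0 : (0 < r)%N by case: (r) r2.
have N_ge : (8 * t.+1 <= N)%N by rewrite leq_pmull // expn_gt0.
pose good (W' : {set G}) := (#|W'| <= N)%N.
have br (W' : {set G}) : W' \subset W -> good W' \/ exists2 v, v \in W' & (N %/ r <= #|nonnbr W' v|)%N.
  move=> _; have [le|gt] := leqP #|W'| N; [by left|right].
  have [/existsP[v /andP[vW' lt]]|] := boolP [exists v, (v \in W') && (#|W'| %/ r < #|nonnbr W' v|)%N].
    by exists v => //; apply: leq_trans (ltnW lt); apply/leq_div2r/ltnW.
  rewrite negb_exists => /forallP small; case: nK.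
  apply: (@dense_complete_minor _ W' _ _ r2); first exact: leq_ltn_trans N_ge gt.
  by move=> v vW'; have := small v; rewrite vW' /= -leqNgt.
have := cliques_in_branching br (fun W' _ => @IH W').
move/leq_trans; apply; rewrite mulnS expnD -(mulnA (_ ^ _)%N).
have base : (#|W|.+1 <= (2 * N).+1)%N by rewrite ltnS.
have exps : (#|W| %/ (N %/ r).+1 <= 2 * r)%N.
  rewrite -ltnS ltn_divLR //; apply: (leq_ltn_trans cW).
  have := ltn_ceil N r_gt0; nia.
apply: leq_mul.
  apply: (@leq_trans ((2 * N).+1 ^ (#|W| %/ (N %/ r).+1))%N); last by rewrite leq_pexp2l.
  by case: (_ %/ _)%N => // e; rewrite leq_exp2r.
rewrite leq_mul2r; apply/orP; right; case: (2 * r * j)%N => // e; rewrite leq_exp2r // ltnS.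
by rewrite leq_pmull.
Qed.

Definition induced (G : sgraph) (W : {set G}) : sgraph :=
  @SGraph {x : G | x \in W} (fun x y => edge (val x) (val y))
    (fun x y => edge_sym (val x) (val y)) (fun x => edge_irrefl (val x)).

Lemma induced_minor (G : sgraph) (W : {set G}) : minor (induced W) G.
Proof.
apply: (@star_model_minor _ _ (val : induced W -> G) insub); split.
- by move=> h; exact: valK.
- by move=> x h xh; left; case: insubP xh => // u _ <- [->].
- by move=> h h' hh'; exists (val h), (val h'); rewrite !valK.
Qed.

Lemma induced_low_degree (G : sgraph) (W : {set G}) (d : nat) :
  (num_arcs (induced W) <= d * #|W|)%N -> (0 < #|W|)%N ->
  exists2 v, v \in W & (#|nbr v :&: W| <= d)%N.
Proof.
move=> le W_gt0.
have cW : #|induced W| = #|W| by rewrite [LHS]card_sig; apply: eq_card.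
have degE (v : induced W) : #|nbr v| = #|nbr (val v) :&: W|.
  rewrite -(card_imset (f := val : induced W -> G)); last by move=> a b /val_inj.
  apply: eq_card => x; rewrite !inE; apply/imsetP/andP => [[y]|[vx xW]].
    by rewrite inE => vy ->; split=> //; exact: (valP y).
  by exists (exist _ x xW); rewrite ?inE.
apply: contrapT => nex.
have : (#|induced W| * d.+1 <= num_arcs (induced W))%N.
  rewrite num_arcs_sum -sum_nat_const; apply: leq_sum => v _; rewrite ltnNge; apply/negP => le'.
  by apply: nex; exists (val v); [exact: (valP v)|rewrite -degE].
rewrite cW; nia.
Qed.

(** Every non-empty clique lies in the neighbourhood, within the later vertices, of its first
    vertex in a degeneracy order, together with that vertex. *)
Lemma cliques_in_degenerate (G : sgraph) (d M : nat) :
  (forall W : {set G}, (0 < #|W|)%N -> exists2 v, v \in W & (#|nbr v :&: W| <= d)%N) ->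
  (forall W : {set G}, #|W| <= d -> cliques_in W <= M)%N ->
  forall W : {set G}, (cliques_in W <= #|W| * M + 1)%N.
Proof.
move=> deg smallM W; have [n] := ubnP #|W|; elim: n W => // n IH W; rewrite ltnS => leW.
have [W0|W_gt0] := posnP #|W|.
  by rewrite (cards0_eq W0) cliques_in0 addn1.
have [v vW dv] := deg W W_gt0; rewrite (cliques_in_split vW).
have := IH (W :\ v); have := smallM _ dv; rewrite (cardsD1 v W) vW in leW * => h1 /(_ leW) h2.
by rewrite mulnDl mul1n -addnA [X in (_ <= X)%N]addnC leq_add.
Qed.

(** All losses are bounded by powers [2 ^ (c * z ^ 5)]: there are [6 * z] halving rounds with
    [8 * z ^ 3] choices each and then [8 * z ^ 4] more choices, each choice
    costing a factor [2 ^ (16 * z)] at most. *)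
Lemma num_cliques_reduction (F : sgraph -> Prop) (t z : nat) (G : sgraph) :
  minor_closed F -> ~ F (complete_graph t) -> F G -> (t < z ^ 6)%N -> (0 < #|G|)%N ->
  exists W : {set G}, {in W, forall x, #|nonnbr W x| <= z ^ 2}%N /\
    (num_cliques G <= #|G| * 2 ^ (849 * z ^ 5) * cliques_in W)%N.
Proof.
move=> mF nK FG tz G_gt0.
have nKG : ~ minor (complete_graph t) G by move=> m; apply: nK; apply: (mF _ _ FG).
pose good (W : {set G}) := [forall x in W, #|nonnbr W x| <= z ^ 2]%N.
have good0 : good set0 by apply/forall_inP => x; rewrite inE.
have [W gW maxW] := @arg_maxnP _ set0 good (@cliques_in G) good0.
exists W; split; first exact/forall_inP.
set M0 := cliques_in W in maxW *.
have z_gt0 : (0 < z)%N by case: (z) tz.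
pose M1 := ((8 * t.+1).+1 ^ (8 * z ^ 4) * M0)%N.
have bound1 (W1 : {set G}) : (#|W1| <= 8 * t.+1)%N -> (cliques_in W1 <= M1)%N.
  move=> cW1.
  have br (W' : {set G}) : W' \subset W1 -> good W' \/ exists2 v, v \in W' & (z ^ 2 <= #|nonnbr W' v|)%N.
    move=> _; have [g|nb] := boolP (good W'); [by left|right].
    by move: nb => /forall_inPn[v vW']; rewrite -ltnNge => /ltnW; exists v.
  have := cliques_in_branching br (fun W' _ => maxW W'); move/leq_trans; apply.
  rewrite leq_mul2r; apply/orP; right.
  have exps : (#|W1| %/ (z ^ 2).+1 <= 8 * z ^ 4)%N.
    rewrite -ltnS ltn_divLR //; apply: (leq_ltn_trans cW1).
    have : (z ^ 6 = z ^ 4 * z ^ 2)%N by rewrite -expnD.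
    nia.
  apply: (@leq_trans ((8 * t.+1).+1 ^ (#|W1| %/ (z ^ 2).+1))%N); last by rewrite leq_pexp2l.
  by case: (_ %/ _)%N => // e; rewrite leq_exp2r.
pose r := (4 * z ^ 3)%N.
have r2 : (16 * t.+1 <= r * r)%N.
  by rewrite /r mulnACA -expnD; lia.
pose d := (2 * (3 * (t * t + t) + 3))%N.
pose N := (2 ^ (6 * z) * (8 * t.+1))%N.
have z6 : (z ^ 6 <= 2 ^ (6 * z))%N by rewrite mulnC expnM leq_exp2r // ltnW // ltn_expl.
have dN : (d <= N)%N.
  have : (t.+1 * (8 * t.+1) <= N)%N by rewrite leq_mul2r; apply/orP; right; lia.
  rewrite /d; nia.
pose M2 := (N.+1 ^ (2 * r * (6 * z)) * M1)%N.
have bound2 (W2 : {set G}) : (#|W2| <= d)%N -> (cliques_in W2 <= M2)%N.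
  by move=> cW2; apply: (cliques_in_halving r2 nKG bound1); apply: leq_trans dN.
have low (W' : {set G}) : (0 < #|W'|)%N -> exists2 v, v \in W' & (#|nbr v :&: W'| <= d)%N.
  move=> W'_gt0; apply: induced_low_degree => //.
  have := num_arcs_bound mF nK (mF _ _ FG (induced_minor W')).
  by rewrite [#|induced W'|]card_sig /=; congr (_ <= _ * _)%N; apply: eq_card.
have := cliques_in_degenerate low bound2 [set: G]; rewrite cliques_in_setT cardsT.
have M0_gt0 : (0 < M0)%N by rewrite -(cliques_in0 G); apply: maxW.
have base1 : ((8 * t.+1).+1 <= 2 ^ (10 * z))%N.
  apply: (@leq_trans (2 ^ 4 * 2 ^ (6 * z))%N); first by lia.
  by rewrite -expnD leq_exp2l //; lia.
have base2 : (N.+1 <= 2 ^ (16 * z))%N.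
  have -> : (16 * z = 6 * z + 10 * z)%N by lia.
  rewrite expnD; apply: leq_trans (leq_mul (leqnn _) base1).
  by rewrite /N [X in (_ <= X)%N]mulnS -addn1 addnC leq_add2r expn_gt0.
have b1 : (M1 <= 2 ^ (80 * z ^ 5) * M0)%N.
  rewrite leq_mul2r; apply/orP; right.
  have -> : (80 * z ^ 5 = 10 * z * (8 * z ^ 4))%N by rewrite mulnACA -expnS.
  by rewrite [X in (_ <= X)%N]expnM leq_exp2r // muln_gt0 expn_gt0 z_gt0.
have b2 : (M2 <= 2 ^ (848 * z ^ 5) * M0)%N.
  have -> : (848 * z ^ 5 = 768 * z ^ 5 + 80 * z ^ 5)%N by rewrite -mulnDl.
  rewrite expnD -mulnA; apply: leq_mul => //.
  have -> : (768 * z ^ 5 = 16 * z * (2 * r * (6 * z)))%N by rewrite /r (expnS z 4) (expnSr z 3); nia.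
  rewrite [X in (_ <= X)%N]expnM leq_exp2r //.
  by rewrite /r !muln_gt0 z_gt0.
move/leq_trans; apply.
have : (0 < 2 ^ (848 * z ^ 5) * M0)%N by rewrite muln_gt0 expn_gt0.
have : (2 * 2 ^ (848 * z ^ 5) <= 2 ^ (849 * z ^ 5))%N.
  rewrite -expnS leq_exp2l //; have : (0 < z ^ 5)%N by rewrite expn_gt0 z_gt0.
  lia.
move: b2; set E := (2 ^ (848 * _))%N; set E' := (2 ^ (849 * _))%N => b2 EE' E_gt0.
apply: (@leq_trans (#|G| * (2 * (E * M0)))%N).
  rewrite mul2n -addnn mulnDr; apply: leq_add; first by rewrite leq_mul2l b2 orbT.
  by apply: leq_trans E_gt0 _; rewrite leq_pmull.
by rewrite -mulnA leq_mul2l; apply/orP; right; rewrite mulnA leq_mul2r EE' orbT.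
Qed.

(** The real number [(N + c) / 2 - a] is the coordinate [b] of the point
    [(a, b)] below the envelope; [N], [a] and [c] count the vertices, the non-adjacent pairs and the
    dominating vertices of the dense part. *)
Lemma num_cliques_upper (F : sgraph -> Prop) (t z : nat) (G : sgraph) :
  minor_closed F -> ~ F (complete_graph t) -> F G -> (t < z ^ 6)%N -> (0 < #|G|)%N ->
  exists a c N, [/\ (2 * a + c <= N)%N,
    forall H, ~ F H ->
      (N + a + c + minn a (matching_number (compl_graph H)) <= 2 * #|H| + 5 * z ^ 5)%N
    & (num_cliques G ^ 2 * 4 ^ a <=
        (#|G| * 2 ^ (849 * z ^ 5)) ^ 2 * (9 ^ a * 2 ^ (c + N)))%N].
Proof.
move=> mF nK FG tz G_gt0.
have [W [deg le]] := num_cliques_reduction mF nK FG tz G_gt0.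
have [ps [cs [P L B]]] := cliques_in_bound W.
exists (size ps), (size cs), #|W|; split=> //.
  move=> H nFH; have nH : ~ minor H G by move=> m; apply: nFH; apply: (mF _ _ FG).
  apply: leq_trans (not_minor_bound deg P nH) _; rewrite leq_add2l -expnD.
  have z_gt0 : (0 < z)%N by case: (z) tz.
  have : (z ^ 4 <= z ^ 5)%N by rewrite leq_pexp2l.
  have : (z ^ 2 <= z ^ 5)%N by rewrite leq_pexp2l.
  have : (1 <= z ^ 5)%N by rewrite expn_gt0 z_gt0.
  rewrite /=; lia.
apply: (@leq_trans ((#|G| * 2 ^ (849 * z ^ 5) * cliques_in W) ^ 2 * 4 ^ size ps)%N).
  by rewrite leq_mul2r leq_exp2r // le orbT.
by rewrite expnMn -mulnA leq_mul2l B orbT.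
Qed.

End UpperBound.

(** * The combinatorial lower bound *)

Section LowerBound.
Import mathcomp.boot.fintype mathcomp.boot.finset.

Section CocktailParty.
Variables a b : nat.

Definition cocktail_rel : rel ('I_a * bool + 'I_b)%type := fun p q =>
  match p, q with
  | inl x, inl y => x.1 != y.1
  | inr x, inr y => x != y
  | _, _ => true
  end.
Lemma cocktail_sym : symmetric cocktail_rel.
Proof. by move=> [x|x] [y|y] //=; rewrite eq_sym. Qed.
Lemma cocktail_irrefl : irreflexive cocktail_rel.
Proof. by move=> [x|x] /=; rewrite eqxx. Qed.

(** The extremal graph of the point [(a, b)]: the join of [a] pairs of non-adjacent
    vertices and of a clique on [b] vertices. *)
Definition cocktail_graph : sgraph := SGraph cocktail_sym cocktail_irrefl.

Lemma card_cocktail : #|cocktail_graph| = (2 * a + b)%N.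
Proof. by rewrite card_sum card_prod !card_ord card_bool mulnC. Qed.

Lemma num_cliques_cocktail : (3 ^ a * 2 ^ b <= num_cliques cocktail_graph)%N.
Proof.
pose f (g : {ffun 'I_a -> option bool} * {set 'I_b}) : {set cocktail_graph} :=
  [set p | match p with inl x => g.1 x.1 == Some x.2 | inr y => y \in g.2 end].
have injf : injective f.
  move=> [g B] [g' B'] /setP E; congr pair.
    apply/ffunP => i; case gi: (g i) => [e|]; case gi': (g' i) => [e'|] //.
    - by have := E (inl (i, e)); rewrite !inE /= gi gi' eqxx => /esym/eqP.
    - by have := E (inl (i, e)); rewrite !inE /= gi gi' eqxx.
    - by have := E (inl (i, e')); rewrite !inE /= gi gi' eqxx.
  by apply/setP => y; have := E (inr y); rewrite !inE.
have -> : (3 ^ a * 2 ^ b = #|[set: {ffun 'I_a -> option bool} * {set 'I_b}]|)%N.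
  rewrite cardsT card_prod card_ffun card_option card_bool card_ord; congr (_ * _)%N.
  by rewrite -cardsT -powersetT card_powerset cardsT card_ord.
rewrite -(card_imset _ injf); apply/subset_leq_card/subsetP => A /imsetP[[g B] _ ->].
rewrite inE; apply/is_cliqueP => -[[i e]|y] [[j e']|y']; rewrite !inE //=.
move=> /eqP gi /eqP gj; apply: contraNneq => /= ij.
by move: gj; rewrite -ij gi => -[->].
Qed.

Lemma card_le_pairs (X : {set cocktail_graph}) :
  (#|X| <= a + b + #|[set i | (inl (i, true) \in X) && (inl (i, false) \in X)]|)%N.
Proof.
pose Xe e := [set i | inl (i, e) \in X].
have sX : X \subset (inr @: [set: 'I_b]) :|:
    ([set inl (i, true) | i in Xe true] :|: [set inl (i, false) | i in Xe false]).
  apply/subsetP => -[[i [|]]|y] xX; rewrite !inE; apply/orP.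
  - by right; apply/orP; left; apply/imsetP; exists i; rewrite ?inE.
  - by right; apply/orP; right; apply/imsetP; exists i; rewrite ?inE.
  - by left; apply/imsetP; exists y.
have h0 := subset_leq_card sX.
have h1 := leq_of_leqif (leq_card_setU (inr @: [set: 'I_b] : {set cocktail_graph})
    ([set inl (i, true) | i in Xe true] :|: [set inl (i, false) | i in Xe false])).
have h2 := leq_of_leqif (leq_card_setU ([set inl (i, true) | i in Xe true] : {set cocktail_graph})
    [set inl (i, false) | i in Xe false]).
have h3 : (#|(inr @: [set: 'I_b] : {set cocktail_graph})| <= b)%N.
  by apply: (leq_trans (leq_imset_card _ _)); rewrite cardsT card_ord.
have h4 e : (#|([set inl (i, e) | i in Xe e] : {set cocktail_graph})| <= #|Xe e|)%N.
  exact: leq_imset_card.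
have h5 := cardsUI (Xe true) (Xe false).
have h6 : (#|Xe true :|: Xe false| <= a)%N by rewrite -[X in (_ <= X)%N](card_ord a) max_card.
have -> : [set i | (inl (i, true) \in X) && (inl (i, false) \in X)] = Xe true :&: Xe false.
  by apply/setP => i; rewrite !inE.
have h7 := leq_trans h2 (leq_add (h4 true) (h4 false)).
apply: leq_trans h0 (leq_trans h1 (leq_trans (leq_add h3 h7) _)).
by rewrite -h5 addnA leq_add2r addnC leq_add2r.
Qed.

(** A model with [s] singleton branch sets has at most [(2 * a + b + s) / 2] branch sets.
    Singletons that form a non-adjacent pair give an edge of a matching in the
    complement of [H], so [s] is at most [a + b] plus the number of such pairs. *)
Lemma loose_model_cocktail (H : sgraph) : loose_model H cocktail_graph ->
  (2 * #|H| <= 3 * a + 2 * b + minn a (matching_number (compl_graph H)))%N.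
Proof.
move=> [rho [surj adj]].
have [c cK] : exists c : H -> cocktail_graph, forall h, rho (c h) = Some h.
  by have [c] := choice surj; exists c.
pose other h x := (rho x == Some h) && (x != c h).
pose L := [set h | ~~ [exists x, other h x]].
pose d h := odflt (c h) [pick x | other h x].
have dP h : h \notin L -> rho (d h) = Some h /\ d h != c h.
  rewrite inE negbK => /existsP[x xo]; rewrite /d; case: pickP => [y /andP[/eqP]//|/(_ x)].
  by rewrite xo.
have lone h x : h \in L -> rho x = Some h -> x = c h.
  rewrite inE negb_exists => /forallP/(_ x); rewrite /other negb_and negbK => + rx.
  by rewrite rx eqxx /= => /eqP.
have injc : injective c by move=> h h' E; apply: Some_inj; rewrite -cK E cK.
have total : (2 * #|H| <= 2 * a + b + #|L|)%N.
  rewrite -card_cocktail.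
  have disj : (c @: [set: H]) :&: (d @: ~: L) = set0.
    apply/setP => x; rewrite !inE; apply/negP => /andP[/imsetP[h _ ->] /imsetP[h']].
    rewrite in_setC => /dP [rd nd] E; have hh' : h = h' by apply: Some_inj; rewrite -cK E rd.
    by rewrite -hh' E -hh' eqxx in nd.
  have cd : (#|d @: ~: L| = #|H| - #|L|)%N.
    rewrite card_in_imset; first by rewrite cardsCs setCK.
    move=> h h'; rewrite !in_setC => /dP[r _] /dP[r' _] E; apply: Some_inj.
    by rewrite -r E r'.
  have := max_card (mem ((c @: [set: H]) :|: (d @: ~: L))).
  by rewrite cardsU disj cards0 subn0 cd card_imset // cardsT; have := max_card (mem L); lia.
pose X := c @: L.
have cX : #|X| = #|L| by rewrite card_imset.
pose Y := [set i | (inl (i, true) \in X) && (inl (i, false) \in X)].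
have XL x : x \in X -> exists2 h, h \in L & rho x = Some h /\ x = c h.
  by move=> /imsetP[h hL ->]; exists h.
pose e i : {set H} := [set h | (rho (inl (i, true)) == Some h) || (rho (inl (i, false)) == Some h)].
have eP i h : i \in Y -> h \in e i -> h \in L /\ exists s, c h = inl (i, s).
  rewrite inE => /andP[/XL[h1 h1L [r1 E1]] /XL[h2 h2L [r2 E2]]].
  rewrite inE r1 r2 => /orP[]/eqP[<-]; split=> //; first by exists true.
  by exists false.
have disje i j h : i \in Y -> j \in Y -> h \in e i -> h \in e j -> i = j.
  by move=> iY jY /(eP _ _ iY)[_ [s E]] /(eP _ _ jY)[_ [s' E']]; move: E; rewrite E' => -[].
have edgeY i : i \in Y -> exists x y, [/\ x != y, ~~ edge x y & e i = [set x; y]].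
  rewrite inE => /andP[/XL[h1 h1L [r1 E1]] /XL[h2 h2L [r2 E2]]]; exists h1, h2; split.
  - by apply/eqP => E; move: E1; rewrite E -E2.
  - apply/negP => /adj [x [y [xy rx ry]]]; move: xy.
    by rewrite (lone _ _ h1L rx) (lone _ _ h2L ry) -E1 -E2 /= eqxx.
  - apply/setP => h; rewrite !inE r1 r2 (inj_eq Some_inj) (inj_eq Some_inj).
    by rewrite !(eq_sym h).
have inje : {in Y &, injective e}.
  move=> i j iY jY E; have [x [y [_ _ eE]]] := edgeY i iY.
  have xi : x \in e i by rewrite eE in_set2 eqxx.
  by apply: (disje i j x iY jY) => //; rewrite -E.
have matchY : (#|Y| <= matching_number (compl_graph H))%N.
  rewrite -(card_in_imset inje).
  apply: (@leq_bigmax_cond _ (@is_matching (compl_graph H)) (fun M => #|M|)).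
  apply/andP; split.
    apply/subsetP => A /imsetP[i /edgeY[x [y [xy nxy eE]]] ->]; rewrite inE.
    by apply/existsP; exists x; apply/existsP; exists y; rewrite /= /compl_rel xy nxy eE /=.
  apply/trivIsetP => A B /imsetP[i iY ->] /imsetP[j jY ->] ne.
  rewrite -setI_eq0; apply/eqP/setP => h; rewrite in_setI in_set0; apply/negP => /andP[hi hj].
  by move: ne; rewrite (disje i j h iY jY hi hj) eqxx.
have := card_le_pairs X; rewrite cX -/Y => cL.
have Ya : (#|Y| <= a)%N by rewrite -[X in (_ <= X)%N](card_ord a) max_card.
have : (#|Y| <= minn a (matching_number (compl_graph H)))%N by rewrite leq_min Ya.
lia.
Qed.

End CocktailParty.

Lemma cocktail_in_family (F : sgraph -> Prop) (a b : nat) :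
  (forall H, minimal_forbidden F H -> exists2 K, iso H K &
    3 * a + 2 * b + minn a (matching_number (compl_graph K)) < 2 * #|K|)%N ->
  F (cocktail_graph a b).
Proof.
move=> small; apply: contrapT => /minimal_forbidden_loose_model [H [mH HG]].
have [K HK lt] := small H mH.
have := loose_model_cocktail (loose_model_trans (iso_loose_model (iso_symm HK)) HG).
by rewrite leqNgt lt.
Qed.

Lemma num_cliques_gt0 (G : sgraph) : (0 < num_cliques G)%N.
Proof. by rewrite -cliques_in_setT -(cliques_in0 G) cliques_in_sub // sub0set. Qed.

(** The empty clique is the only one that both sides share. *)
Lemma num_cliques_disjoint_union (G H : sgraph) :
  (num_cliques G + num_cliques H <= num_cliques (disjoint_union G H) + 1)%N.
Proof.
pose CG := [set A : {set G} | is_clique A]; pose CH := [set A : {set H} | is_clique A].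
pose fl (A : {set G}) : {set disjoint_union G H} := inl @: A.
pose fr (A : {set H}) : {set disjoint_union G H} := inr @: A.
have inl_inj : injective (inl : G -> disjoint_union G H) by move=> ? ? [].
have inr_inj : injective (inr : H -> disjoint_union G H) by move=> ? ? [].
have -> : num_cliques G = #|fl @: CG| by rewrite card_imset //; exact: imset_inj.
have -> : num_cliques H = #|fr @: CH| by rewrite card_imset //; exact: imset_inj.
rewrite -cardsUI; apply: leq_add.
  apply/subset_leq_card/subsetP => A; rewrite in_setU => /orP[] /imsetP[B]; rewrite !inE => /is_cliqueP cB ->.
    apply/is_cliqueP => x y /imsetP[x' xB ->] /imsetP[y' yB ->] xy.
    by apply: cB => //; apply: contraNneq xy => ->.
  apply/is_cliqueP => x y /imsetP[x' xB ->] /imsetP[y' yB ->] xy.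
  by apply: cB => //; apply: contraNneq xy => ->.
rewrite -(cards1 (set0 : {set disjoint_union G H})); apply/subset_leq_card/subsetP => A.
rewrite !inE => /andP[/imsetP[B _ ->] /imsetP[C _ E]]; apply/eqP/setP => x; rewrite inE.
apply/negP => xB; have := xB; rewrite E => /imsetP[y _ xy].
by move: xB => /imsetP[z _]; rewrite xy.
Qed.

Lemma complete0_in_family (F : sgraph -> Prop) (G : sgraph) :
  minor_closed F -> F G -> F (complete_graph 0).
Proof.
move=> mF FG; apply: (mF _ _ FG).
have no (i : complete_graph 0) : False by case: i.
by apply: (@star_model_minor _ _ (fun i => match no i with end) (fun=> None)); split=> // i; case: (no i).
Qed.

Lemma copies_in_family (F : sgraph -> Prop) (B1 B2 : sgraph) (q r : nat) :
  minor_closed F -> union_closed F -> F B1 -> F B2 ->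
  exists G, [/\ F G, #|G| = (q * #|B1| + r * #|B2|)%N &
    (q * (num_cliques B1).-1 + 1 <= num_cliques G)%N].
Proof.
move=> mF uF F1 F2; elim: q => [|q [G [FG cG nG]]].
  elim: r => [|r [G [FG cG nG]]].
    exists (complete_graph 0); split; rewrite ?card_ord //; last exact: num_cliques_gt0.
    exact: complete0_in_family F1.
  exists (disjoint_union B2 G); split; [exact: uF|by rewrite card_sum cG mulSn|].
  exact: num_cliques_gt0.
exists (disjoint_union B1 G); split; [exact: uF|by rewrite card_sum cG mulSn addnA|].
have := num_cliques_disjoint_union B1 G; have := num_cliques_gt0 B1; rewrite mulSn; lia.
Qed.

Lemma num_cliques_lower (F : sgraph -> Prop) (a b n : nat) :
  minor_closed F -> union_closed F ->
  (forall H, minimal_forbidden F H -> 1 < #|H|)%N ->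
  (forall H, minimal_forbidden F H -> exists2 K, iso H K &
    3 * a + 2 * b + minn a (matching_number (compl_graph K)) < 2 * #|K|)%N ->
  (2 * a + b <= n)%N ->
  exists G, [/\ F G, #|G| = n &
    (n * (3 ^ a * 2 ^ b) <= 4 * (2 * a + b).+1 * num_cliques G)%N].
Proof.
move=> mF uF big1 big le.
have F1 : F (cocktail_graph 0 1).
  apply: cocktail_in_family => H /big1 gt1; exists H; last by rewrite min0n; lia.
  by exists id; split => //; exists id.
have FB := cocktail_in_family big.
have [E0|m_gt0] := posnP (2 * a + b)%N.
  have [G [FG cG nG]] := copies_in_family n 0 mF uF F1 F1.
  exists G; split=> //; first by rewrite cG card_cocktail; lia.
  have [-> ->] : a = 0%N /\ b = 0%N by lia.
  have := num_cliques_cocktail 0 1; rewrite !expn0 expn1 => h; move: nG; nia.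
have [G [FG cG nG]] := copies_in_family (n %/ (2 * a + b)) (n %% (2 * a + b)) mF uF FB F1.
exists G; split=> //; first by rewrite cG !card_cocktail muln1 -divn_eq.
have := num_cliques_cocktail a b; set c := (3 ^ a * 2 ^ b)%N; set k := num_cliques (cocktail_graph _ _).
have c2 : (2 <= c)%N.
  have : (0 < 3 ^ a)%N by rewrite expn_gt0.
  have : (0 < 2 ^ b)%N by rewrite expn_gt0.
  rewrite /c; case: (a) m_gt0 => [|a'] m_gt0; last by rewrite expnS; nia.
  by case: (b) m_gt0 => // b' _; rewrite expnS; nia.
move: nG; rewrite -/k; have := ltn_ceil n m_gt0; have : (0 < n %/ (2 * a + b))%N by rewrite divn_gt0.
set q := (n %/ _)%N; set m := (2 * a + b)%N => q_gt0 nq nG ck.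
have n2 : (n <= 2 * (q * m))%N by nia.
have cc : (c <= 2 * k.-1)%N by lia.
apply: (@leq_trans (2 * (q * m) * (2 * k.-1))%N); first exact: leq_mul.
apply: (@leq_trans (4 * m * (q * k.-1))%N); first by nia.
by apply: leq_mul; [rewrite leq_mul2l leqnSn orbT|lia].
Qed.

End LowerBound.

(** * The lower envelope *)

Local Open Scope classical_set_scope.
Local Open Scope ring_scope.

Section EnvelopeGeometry.
Variable R : realType.
Implicit Types (a b y : R) (p : R * R).

Lemma bent_line_sub (n m : nat) (a y : R) : a <= y ->
  bent_line n m a - 2 * (y - a) <= bent_line n m y <= bent_line n m a - 3 / 2 * (y - a).
Proof. by rewrite /bent_line => ay; case: ltP => h1; case: ltP => h2; apply/andP; split; lra. Qed.

(** One-sided germs of affine functions: [d] is [1] on the right and [- 1] on the left, so that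
    both sides of a point are treated at once.  The pair [p] holds the slope and the intercept. *)
Definition germ (d : R) (f : R -> R) (a : R) (p : R * R) : Prop :=
  f a = p.1 * a + p.2 /\
  exists2 e, 0 < e & forall h, 0 < h < e -> f (a + d * h) = p.1 * (a + d * h) + p.2.

(** If the two lines cross at [a], their slopes decide; otherwise the smaller one at [a]
    stays smaller nearby. *)
Lemma germ_min (d : R) (f g : R -> R) (a : R) (p q : R * R) :
  germ d f a p -> germ d g a q ->
  germ d (fun y => Num.min (f y) (g y)) a p \/ germ d (fun y => Num.min (f y) (g y)) a q.
Proof.
move=> [fa [e e0 fe]] [ga [e' e0' ge]].
pose c := d * (q.1 - p.1).
have diff h : q.1 * (a + d * h) + q.2 - (p.1 * (a + d * h) + p.2) = (g a - f a) + c * h.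
  by rewrite fa ga /c; ring.
have step e1 : 0 < e1 -> (forall h, 0 < h < e1 -> 0 <= (g a - f a) + c * h) -> f a <= g a ->
    germ d (fun y => Num.min (f y) (g y)) a p.
  move=> e1_gt0 ch fg; split; first by rewrite min_l // fa.
  exists (Num.min e1 (Num.min e e')); first by rewrite !lt_min e0 e0' e1_gt0.
  move=> h /andP[h0]; rewrite !lt_min => /and3P[h1 h2 h3].
  have [H1 H2] : 0 < h < e /\ 0 < h < e' by rewrite h0 h2 h3.
  rewrite (fe _ H1) (ge _ H2) min_l // -subr_ge0 diff; apply: ch.
  by rewrite h0 h1.
have step' e1 : 0 < e1 -> (forall h, 0 < h < e1 -> (g a - f a) + c * h <= 0) -> g a <= f a ->
    germ d (fun y => Num.min (f y) (g y)) a q.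
  move=> e1_gt0 ch fg; split; first by rewrite min_r // ga.
  exists (Num.min e1 (Num.min e e')); first by rewrite !lt_min e0 e0' e1_gt0.
  move=> h /andP[h0]; rewrite !lt_min => /and3P[h1 h2 h3].
  have [H1 H2] : 0 < h < e /\ 0 < h < e' by rewrite h0 h2 h3.
  rewrite (fe _ H1) (ge _ H2) min_r // -subr_le0 diff; apply: ch.
  by rewrite h0 h1.
have bound x h : 0 < x -> 0 < h < x / (`|c| + 1) -> `|c * h| <= x.
  move=> x0 /andP[h0]; have c1 : 0 < `|c| + 1 by rewrite ltr_wpDl.
  rewrite ltr_pdivlMr // => lt; rewrite normrM (gtr0_norm h0).
  by apply/ltW/(le_lt_trans _ lt); rewrite mulrC ler_pM2l // lerDl.
have pos x : 0 < x -> 0 < x / (`|c| + 1) by move=> x0; rewrite divr_gt0 // ltr_wpDl.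
have [lt|gt|E] := ltgtP (f a) (g a).
- left; apply: (step _ (pos (g a - f a) _)); rewrite ?subr_gt0 //; last exact: ltW.
  by move=> h /bound; rewrite subr_gt0 => /(_ lt); rewrite ler_norml => /andP[]; lra.
- right; apply: (step' _ (pos (f a - g a) _)); rewrite ?subr_gt0 //; last exact: ltW.
  by move=> h /bound; rewrite subr_gt0 => /(_ gt); rewrite ler_norml => /andP[]; lra.
- have [c0|c0] := leP 0 c.
    left; apply: (step 1); rewrite ?ltr01 ?E // => h /andP[h0 _].
    by rewrite subrr add0r mulr_ge0 // ltW.
  right; apply: (step' 1); rewrite ?ltr01 ?E // => h /andP[h0 _].
  by rewrite subrr add0r nmulr_rle0 // ltW.
Qed.

Variables (k : nat) (t x : 'I_k.+1 -> nat).
Notation m := (@min_line R k t x).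

Definition steep_line (i : 'I_k.+1) : R * R := (- 2, (t i)%:R).
Definition flat_line (i : 'I_k.+1) : R * R := (- (3 / 2), (t i)%:R - 1 / 2 * (x i)%:R).
Definition lines : seq (R * R) :=
  [seq steep_line i | i <- enum 'I_k.+1] ++ [seq flat_line i | i <- enum 'I_k.+1].

Lemma steep_in_lines i : steep_line i \in lines.
Proof. by rewrite mem_cat map_f ?mem_enum. Qed.
Lemma flat_in_lines i : flat_line i \in lines.
Proof. by rewrite mem_cat map_f ?orbT ?mem_enum. Qed.

Lemma lines_slope p : p \in lines -> p.1 = - 2 \/ p.1 = - (3 / 2).
Proof. by rewrite mem_cat => /orP[] /mapP[i _ ->]; [left|right]. Qed.

Lemma bent_line_germ (d : R) (i : 'I_k.+1) (a : R) : d = 1 \/ d = - 1 ->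
  exists2 p, p \in lines & germ d (fun y => bent_line (t i) (x i) y) a p.
Proof.
case=> ->; [have [lt|ge] := ltP a (x i)%:R | have [lt|ge] := ltP (x i)%:R a].
- exists (steep_line i); [exact: steep_in_lines|split; rewrite /bent_line /=].
    by rewrite lt; lra.
  exists ((x i)%:R - a) => [|h /andP[h0 h1]]; first by rewrite subr_gt0.
  by rewrite ifT; lra.
- exists (flat_line i); [exact: flat_in_lines|split; rewrite /bent_line /=].
    by rewrite ltNge ge /=; lra.
  by exists 1 => // h /andP[h0 h1]; rewrite ifF; [lra|apply/negbTE; rewrite -leNgt; lra].
- exists (flat_line i); [exact: flat_in_lines|split; rewrite /bent_line /=].
    by rewrite ltNge (ltW lt) /=; lra.
  exists (a - (x i)%:R) => [|h /andP[h0 h1]]; first by rewrite subr_gt0.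
  by rewrite ifF; [lra|apply/negbTE; rewrite -leNgt; lra].
- exists (steep_line i); [exact: steep_in_lines|split; rewrite /bent_line /=].
    by case: ltP => ?; lra.
  by exists 1 => // h /andP[h0 h1]; rewrite ifT; lra.
Qed.

Lemma min_line_germ (d : R) (a : R) : d = 1 \/ d = - 1 ->
  exists2 p, p \in lines & germ d (m : R -> R) a p.
Proof.
move=> d1; rewrite /min_line; elim: (index_enum _) => [|i r [p pin gp]].
  have [p pin [E [e e0 pe]]] := bent_line_germ ord0 a d1; exists p => //; split.
    by rewrite big_nil.
  by exists e => // h he; rewrite big_nil pe.
have [q qin gq] := bent_line_germ i a d1.
have ext s : germ d (fun y => Num.min (bent_line (t i) (x i) y)
    (\big[Num.min/bent_line (t ord0) (x ord0) y]_(j <- r) bent_line (t j) (x j) y)) a s ->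
  germ d (fun y => \big[Num.min/bent_line (t ord0) (x ord0) y]_(j <- i :: r) bent_line (t j) (x j) y) a s.
  move=> [E [e e0 he]]; split; first by rewrite big_cons.
  by exists e => // h /he; rewrite big_cons.
by case: (germ_min gq gp) => /ext; [exists q|exists p].
Qed.

Lemma min_line_le (i : 'I_k.+1) (a : R) : m a <= bent_line (t i) (x i) a.
Proof. exact: bigmin_le. Qed.

Lemma min_line_attained (a : R) : exists i, m a = bent_line (t i) (x i) a.
Proof.
rewrite /min_line; elim/big_ind: _ => [|u v [i ->] [j ->]|i _]; first by exists ord0.
  by rewrite minEle; case: ifP => _; [exists i|exists j].
by exists i.
Qed.

Lemma min_line_sub (a y : R) : a <= y ->
  m a - 2 * (y - a) <= m y <= m a - 3 / 2 * (y - a).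
Proof.
move=> ay; apply/andP; split.
  have [i ->] := min_line_attained y; have /andP[+ _] := bent_line_sub (t i) (x i) ay.
  by apply: le_trans; rewrite lerB // min_line_le.
have [i ->] := min_line_attained a; have /andP[_] := bent_line_sub (t i) (x i) ay.
exact/le_trans/min_line_le.
Qed.

Lemma min_line0_ge0 : 0 <= m 0.
Proof.
have [i ->] := min_line_attained 0; rewrite /bent_line.
have := ler0n R (t i); case: ltP; have := ler0n R (x i); lra.
Qed.

Lemma slope_changes_lines (a : R) : slope_changes_at t x a ->
  exists p q, [/\ p \in lines, q \in lines, p.1 != q.1 & p.1 * a + p.2 = q.1 * a + q.2].
Proof.
move=> [s [s' [ss' near_l near_r]]].
have [p pin [pa [e e0 pe]]] := min_line_germ a (or_intror (erefl (- 1 : R))).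
have [q qin [qa [e' e0' qe]]] := min_line_germ a (or_introl (erefl (1 : R))).
exists p, q; split; rewrite -?pa -?qa //.
have sp : s = p.1.
  have ae : a - e < a by rewrite gtrBl.
  have [y [y1 y2 y3]] : exists y, [/\ m y = m a + s * (y - a), a - e < y & y < a].
    apply: (@filter_ex _ a^'-); near=> y; split; near: y.
    - exact: near_l.
    - exact: nbhs_left_gt.
    - exact: nbhs_left_lt.
  have h : 0 < a - y < e by apply/andP; split; lra.
  have := pe _ h; rewrite (_ : a + - 1 * (a - y) = y); last by ring.
  rewrite y1 pa => E; have ya : y - a != 0 by lra.
  by apply: (mulIf ya); lra.
have sq : s' = q.1.
  have ae : a < a + e' by rewrite ltrDl.
  have [y [y1 y2 y3]] : exists y, [/\ m y = m a + s' * (y - a), y < a + e' & a < y].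
    apply: (@filter_ex _ a^'+); near=> y; split; near: y.
    - exact: near_r.
    - exact: nbhs_right_lt.
    - exact: nbhs_right_gt.
  have h : 0 < y - a < e' by apply/andP; split; lra.
  have := qe _ h; rewrite (_ : a + 1 * (y - a) = y); last by ring.
  rewrite y1 qa => E; have ya : y - a != 0 by lra.
  by apply: (mulIf ya); lra.
by rewrite -sp -sq.
Unshelve. all: by end_near. Qed.

(** A slope can only change where two of the finitely many lines cross. *)
Lemma finite_extreme_points : finite_set (@extreme_points R k t x).
Proof.
pose crossings := [seq (q.2 - p.2) / (p.1 - q.1) | p <- lines, q <- lines].
have [z zP] : exists z : R, forall a, m a = 0 -> a = z.
  have [[z z0]|nz] := pselect (exists z : R, m z = 0); last first.
    by exists 0 => a a0; case: nz; exists a.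
  exists z => a a0; have [/ltW az|/ltW az|//] := ltgtP a z.
  - by have := min_line_sub az; rewrite z0 a0 => /andP[]; lra.
  - by have := min_line_sub az; rewrite z0 a0 => /andP[]; lra.
apply: (@sub_finite_set _ _ ((fun a : R => (a, m a)) @` [set` [:: 0, z & crossings]])); last first.
  exact/finite_image/finite_seq.
move=> [a b] [[/= a0 bE b0] ext]; exists a; last by rewrite bE.
case: ext => /= [->|bz|/slope_changes_lines [p [q [pin qin pq E]]]].
- by rewrite /= inE eqxx.
- by rewrite /= (zP a) ?inE ?eqxx ?orbT // -bE.
- rewrite /= !inE; apply/orP; right; apply/orP; right.
  have -> : a = (q.2 - p.2) / (p.1 - q.1).
    have npq : p.1 - q.1 != 0 by rewrite subr_eq0.
    by apply: (mulIf npq); rewrite divfK //; lra.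
  exact: allpairs_f.
Qed.

Lemma min_line_continuous : continuous (m : R -> R).
Proof.
move=> a; apply/cvgrPdist_le => e e0; near=> y.
have ya : `|a - y| < e / 2.
  near: y; have /cvgrPdist_lt := @cvg_id _ (nbhs a).
  by apply; rewrite divr_gt0.
have [h|/ltW h] := leP a y.
  have := min_line_sub h => /andP[h1 h2]; rewrite ger0_norm; last by lra.
  by move: ya; rewrite ler0_norm; lra.
have := min_line_sub h => /andP[h1 h2]; rewrite ler0_norm; last by lra.
by move: ya; rewrite ger0_norm; lra.
Unshelve. all: by end_near. Qed.

Variable c : R.
Hypothesis c_slope : 3 / 2 < c < 2.

(** The objective [c * a + b] strictly increases along segments of slope [- (3 / 2)] and strictly
    decreases along those of slope [- 2]; at a maximum inside the curve the slope therefore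
    changes from the former to the latter. *)
Lemma extreme_max_on_curve (a : R) : 0 <= a -> 0 <= m a ->
  exists2 p, extreme_points t x p & c * a + m a <= c * p.1 + p.2.
Proof.
have /andP[c1 c2] := c_slope.
move=> a0 ma0.
have cont A B : {within `[A, B], continuous (m : R -> R)}.
  exact/continuous_subspaceT/min_line_continuous.
have [A /andP[aA _] mA0] : exists2 A, A \in `[a, a + m a]%R & m A = 0.
  apply: IVT => //; first by rewrite lerDl.
  have := @min_line_sub a (a + m a); rewrite lerDl => /(_ ma0) /andP[_].
  by move=> h; rewrite ge_min le_max ma0 /= andbT; apply/orP; right; lra.
have aA' : a <= A by exact: aA.
have [z /andP[z0 zA] zmax] : exists2 z, z \in `[0, A]%R &
    forall y, y \in `[0, A]%R -> c * y + m y <= c * z + m z.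
  apply: (@EVT_max _ (fun y => c * y + m y)); first exact: le_trans aA'.
  apply: continuous_subspaceT => y; apply: cvgD; last exact: min_line_continuous.
  by apply: cvgM; [exact: cvg_cst|exact: cvg_id].
have {}z0 : 0 <= z by exact: z0.
have {}zA : z <= A by exact: zA.
have zmax' y : 0 <= y -> y <= A -> c * y + m y <= c * z + m z.
  by move=> h1 h2; apply: zmax; rewrite in_itv /= h1 h2.
have mz : 0 <= m z by have := min_line_sub zA; rewrite mA0 => /andP[_]; lra.
exists (z, m z); last exact: zmax'.
split; first by split.
have [->|z_neq0] := eqVneq z 0; first by constructor 1.
have [->|z_neqA] := eqVneq z A; first by constructor 2.
have z_gt0 : 0 < z by rewrite lt_neqAle eq_sym z_neq0.
have z_ltA : z < A by rewrite lt_neqAle z_neqA.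
constructor 3.
have [p pin [pz [e e0 pe]]] := min_line_germ z (or_intror (erefl (- 1 : R))).
have [q qin [qz [e' e0' qe]]] := min_line_germ z (or_introl (erefl (1 : R))).
have slope_p : p.1 = - (3 / 2).
  case: (lines_slope pin) => // sp.
  pose h := Num.min e z / 2.
  have h0 : 0 < Num.min e z by rewrite lt_min e0 z_gt0.
  have [h1 h2] : Num.min e z <= e /\ Num.min e z <= z by rewrite !ge_min !lexx orbT.
  have he : 0 < h < e by apply/andP; split; rewrite /h; lra.
  have := zmax' (z + - 1 * h); rewrite (pe _ he) pz sp => H.
  by have := H _ _; rewrite /h in he *; nra.
have slope_q : q.1 = - 2.
  case: (lines_slope qin) => // sq.
  pose h := Num.min e' (A - z) / 2.
  have h0 : 0 < Num.min e' (A - z) by rewrite lt_min e0' subr_gt0.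
  have [h1 h2] : Num.min e' (A - z) <= e' /\ Num.min e' (A - z) <= A - z.
    by rewrite !ge_min !lexx orbT.
  have he : 0 < h < e' by apply/andP; split; rewrite /h; lra.
  have := zmax' (z + 1 * h); rewrite (qe _ he) qz sq => H.
  by have := H _ _; rewrite /h in he *; nra.
exists p.1, q.1; split=> /=; first by rewrite slope_p slope_q; lra.
  near=> y.
  have yz : y < z by near: y; exact: nbhs_left_lt.
  have ye : z - e < y by near: y; apply: nbhs_left_gt; rewrite gtrBl.
  have h : 0 < z - y < e by apply/andP; split; lra.
have := pe _ h; rewrite (_ : z + - 1 * (z - y) = y); last by ring.
  by move=> ->; rewrite pz; ring.
near=> y.
have yz : z < y by near: y; exact: nbhs_right_gt.
have ye : y < z + e' by near: y; apply: nbhs_right_lt; rewrite ltrDl.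
have h : 0 < y - z < e' by apply/andP; split; lra.
have := qe _ h; rewrite (_ : z + 1 * (y - z) = y); last by ring.
by move=> ->; rewrite qz; ring.
Unshelve. all: by end_near. Qed.

(** Above the envelope by at most [e], the point is first moved down to the envelope; if this
    would lead below the axis, it is first moved to the left by [e] or to the axis. *)
Lemma extreme_max (a b e : R) : 0 <= a -> 0 <= b -> 0 <= e ->
  (forall i, b <= bent_line (t i) (x i) a + e) ->
  exists2 p, extreme_points t x p & c * a + b <= c * p.1 + p.2 + 3 * e.
Proof.
have /andP[c1 c2] := c_slope.
move=> a0 b0 e0 le.
have bm : b <= m a + e by have [i ->] := min_line_attained a.
have [ma|ma] := leP 0 (m a).
  by have [p pE ple] := extreme_max_on_curve a0 ma; exists p => //; lra.
have [ea|/ltW ae] := leP e a.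
  have ha : a - e <= a by rewrite gerBl.
  have /andP[_ h] := min_line_sub ha.
  have [||p pE ple] := @extreme_max_on_curve (a - e); [lra|lra|].
  by exists p => //; have := min_line_sub ha; nra.
have [p pE ple] := extreme_max_on_curve (lexx 0) min_line0_ge0; exists p => //.
have := min_line0_ge0; nra.
Qed.

End EnvelopeGeometry.

(** * Exponents and the error term *)

Section Exponents.
Variable R : realType.

Lemma ln2_gt0 : 0 < ln (2 : R).
Proof. by rewrite ln_gt0 // ltr1n. Qed.

Lemma log2_3_bounds : 3 / 2 < log2 (3 : R) < 2.
Proof.
have l2 := ln2_gt0.
have l8 : ln (2 : R) *+ 3 < ln 3 *+ 2.
  by rewrite -!lnXn ?ltr0n // ltr_ln ?posrE ?exprn_gt0 ?ltr0n // -!natrX ltr_nat.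
have l4 : ln (3 : R) < ln 2 *+ 2.
  by rewrite -lnXn ?ltr0n // ltr_ln ?posrE ?exprn_gt0 ?ltr0n // -natrX ltr_nat.
rewrite /log2 ltr_pdivlMr // ltr_pdivrMr //.
by apply/andP; split; lra.
Qed.

Lemma powR2_log2_3 (r : R) : 2 `^ (log2 3 * r) = 3 `^ r.
Proof.
have l2 := ln2_gt0.
rewrite /powR !ifF ?pnatr_eq0 //; congr expR.
by rewrite /log2 mulrAC divfK ?gt_eqF // mulrC.
Qed.

Lemma powR2_nat (n : nat) : (2 : R) `^ n%:R = (2 ^ n)%:R.
Proof. by rewrite powR_mulrn // natrX. Qed.

Lemma powR2D (r s : R) : (2 : R) `^ (r + s) = 2 `^ r * 2 `^ s.
Proof. by rewrite powRD // pnatr_eq0 implybT. Qed.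

Lemma powR2_le (r s : R) : r <= s -> (2 : R) `^ r <= 2 `^ s.
Proof. by apply: ler_powR; rewrite ler1n. Qed.

(** The combinatorial bound is stated with squares because [b = (N + c) / 2 - a] may be a
    half-integer. *)
Lemma sqr_bound_powR (cl X a c N : nat) :
  (cl ^ 2 * 4 ^ a <= X ^ 2 * (9 ^ a * 2 ^ (c + N)))%N ->
  cl%:R <= X%:R * (2 : R) `^ (log2 3 * a%:R + ((N + c)%:R / 2 - a%:R)).
Proof.
move=> le; set V := _ `^ _.
have V0 : 0 <= V by exact: powR_ge0.
have VV : V ^+ 2 * (4 ^ a)%:R = (9 ^ a * 2 ^ (c + N))%:R.
  have -> : (4 ^ a)%:R = (2 : R) `^ a%:R * 2 `^ a%:R.
    by rewrite powR2_nat -natrM -expnMn.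
  have -> : (9 ^ a * 2 ^ (c + N))%:R = (2 : R) `^ (log2 3 * a%:R) * 2 `^ (log2 3 * a%:R) * 2 `^ (c + N)%:R.
    by rewrite powR2_log2_3 powR_mulrn // powR2_nat -natrX -!natrM -expnMn.
  rewrite expr2 /V -!powR2D; congr (_ `^ _).
  by rewrite addnC; lra.
have : (cl%:R * (2 : R) `^ a%:R) ^+ 2 <= (X%:R * V * 2 `^ a%:R) ^+ 2.
  have E4 : ((2 : R) `^ a%:R) ^+ 2 = (4 ^ a)%:R by rewrite powR2_nat -natrX -expnM mulnC expnM.
  by rewrite !exprMn E4 -[leRHS]mulrA VV -!natrX -!natrM ler_nat.
rewrite ler_pXn2r ?nnegrE ?mulr_ge0 ?powR_ge0 //.
by rewrite ler_pM2r // powR_gt0.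
Qed.

(** The sixth root of [m], rounded up to an integer [z] with [m < z ^ 6]: all losses are at most
    [2 ^ (c * z ^ 5)]. *)
Lemma sixth_root (m : nat) : exists z : nat, [/\ (0 < z)%N, (z.-1 ^ 6 <= m)%N & (m < z ^ 6)%N].
Proof.
have ex : exists z : nat, (m < z ^ 6)%N.
  exists m.+1; apply: (@leq_trans (m.+1 ^ 1)%N); first by rewrite expn1.
  by rewrite leq_pexp2l.
case: (ex_minnP ex) => z lt minz; have z_gt0 : (0 < z)%N by case: (z) lt.
exists z; split => //; rewrite leqNgt; apply/negP => /minz.
by rewrite leqNgt prednK // leqnn.
Qed.

Lemma fifth_power_sublinear (zf : nat -> nat) (C : nat) :
  (forall m, [/\ 0 < zf m, (zf m).-1 ^ 6 <= m & m < zf m ^ 6])%N ->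
  ((C * zf m ^ 5)%:R / m%:R) @[m --> \oo] --> (0 : R).
Proof.
move=> zP; apply/cvgrPdist_le => e e0.
pose K := (Num.Def.archi_bound ((C * 32)%:R / e)).+1.
near=> m.
have mK : (K ^ 6 <= m)%N by near: m; exact: nbhs_infty_ge.
have [z0 lo hi] := zP m; set z := zf m in z0 lo hi *.
have Kz : (K < z)%N by rewrite -(@ltn_exp2r K z 6) //; exact: leq_ltn_trans mK hi.
have [s zE] : exists s, z = s.+1 by exists z.-1; rewrite prednK.
rewrite zE in lo Kz *; rewrite /= in lo; rewrite ltnS in Kz.
have s0 : (0 < s)%N by apply: leq_trans Kz.
have m0 : (0 < m)%N by apply: leq_trans lo; rewrite expn_gt0 s0.
rewrite sub0r normrN ger0_norm ?divr_ge0 // ler_pdivrMr ?ltr0n //.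
have Ce : (C * 32)%:R <= e * s%:R.
  rewrite mulrC -ler_pdivrMr //; apply: le_trans (ltW (archi_boundP _)) _.
    by rewrite divr_ge0 // ltW.
  by rewrite ler_nat; apply: leq_trans Kz; apply: leqnSn.
have z5 : (s.+1 ^ 5 <= 32 * s ^ 5)%N.
  by rewrite -[32%N]/(2 ^ 5)%N -expnMn leq_exp2r // mul2n -addnn -addn1 leq_add2l.
apply: (@le_trans _ _ ((C * 32)%:R * (s ^ 5)%:R)).
  by rewrite -natrM ler_nat -mulnA leq_mul2l z5 orbT.
apply: (@le_trans _ _ (e * s%:R * (s ^ 5)%:R)); first by rewrite ler_wpM2r.
by rewrite -mulrA -natrM -expnS ler_wpM2l ?ler_nat // ltW.
Unshelve. all: by end_near. Qed.

End Exponents.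

Section MaxExtreme.
Variables (R : realType) (k : nat) (t x : 'I_k.+1 -> nat).

Lemma le_max_extreme (e : R) (p : R * R) : extreme_points t x p ->
  2 `^ (log2 3 * p.1 + p.2 + e) <= max_extreme t x e.
Proof.
move=> pE; rewrite /max_extreme.
apply: (@bigmax_sup_seq _ _ _ _ _ p) => //.
by rewrite in_fset_set ?inE //; exact: finite_extreme_points.
Qed.

Lemma max_extreme_attained (e : R) : exists2 p, extreme_points t x p &
  max_extreme t x e <= 2 `^ (log2 3 * p.1 + p.2 + e).
Proof.
have [p0 p0E _] := extreme_max_on_curve (log2_3_bounds R) (lexx 0) (@min_line0_ge0 R k t x).
rewrite /max_extreme big_seq; elim/big_ind: _ => [|u v [p pE up] [q qE vq]|p].
- by exists p0; rewrite ?powR_ge0.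
- by case: (leP u v) => _; [exists q|exists p].
- rewrite in_fset_set; last exact: finite_extreme_points.
  by rewrite inE => pE; exists p.
Qed.

End MaxExtreme.

(** * Conclusion *)

Lemma bent_line_of_nat (R : realType) (n y a : nat) :
  2 * bent_line n y (a%:R : R) + (3 * a + minn a y)%:R = (2 * n)%:R.
Proof.
rewrite /bent_line natrD !natrM ltr_nat; by case: ltnP => _; lra.
Qed.

(** The integer point [(a', b')] is obtained by rounding [(a, b)] down, and then
    down once more to get strictly below all the bent lines. *)
Lemma rounding_below (R : realType) (k : nat) (t x : 'I_k.+1 -> nat) (a b : R) (i : 'I_k.+1)
    (a' := (Num.trunc a).-1) (b' := (Num.trunc b).-1) :
  0 <= a -> 0 <= b -> b <= bent_line (t i) (x i) a -> (0 < t i)%N ->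
  (3 * a' + 2 * b' + minn a' (x i) < 2 * t i)%N.
Proof.
move=> a0 b0 bl ti.
suff lt : b'%:R < bent_line (t i) (x i) (a'%:R : R).
  have := bent_line_of_nat R (t i) (x i) a'.
  by rewrite -(ltr_nat R) !natrD; lra.
have /andP[ta _] := truncn_itv a0; have /andP[tb _] := truncn_itv b0.
have b'b : b'%:R <= b by apply: le_trans tb; rewrite ler_nat leq_pred.
have [a1|a1] := posnP (Num.trunc a).
  have a'0 : a' = 0%N by rewrite /a' a1.
  have tE : bent_line (t i) (x i) (a'%:R : R) = (t i)%:R.
    by have := bent_line_of_nat R (t i) (x i) a'; rewrite a'0 min0n !natrM /=; lra.
  have [b1|b1] := posnP (Num.trunc b).
    by rewrite tE /b' b1 ltr0n.
  have bE : b'%:R + 1 = (Num.trunc b)%:R :> R by rewrite natr1 /b' prednK.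
  have /andP[_] := bent_line_sub (t i) (x i) a0.
  have a'R : a'%:R = 0 :> R by rewrite a'0.
  by rewrite a'R in tE *; rewrite tE; lra.
have aE : a'%:R + 1 = (Num.trunc a)%:R :> R by rewrite natr1 /a' prednK.
have a'a : a'%:R <= a by lra.
have /andP[_] := bent_line_sub (t i) (x i) a'a; lra.
Qed.

Theorem theorem1p3 (R : realType) :
  exists (g : nat -> R) (C : nat),
    [/\ forall m : nat, 0 <= g m,
        (g m / m%:R) @[m --> \oo] --> (0 : R)
      & forall (F : sgraph -> Prop) (k : nat) (Hs : 'I_k.+1 -> sgraph),
          minor_closed F ->
          union_closed F ->
          lists_minimal_forbidden F Hs ->
          (forall i j : 'I_k.+1, (i <= j)%N ->
             (num_vertices (Hs i) <= num_vertices (Hs j))%N) ->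
          let t (i : 'I_k.+1) := num_vertices (Hs i) in
          let x (i : 'I_k.+1) := matching_number (compl_graph (Hs i)) in
          let t1 := t ord0 in
          [/\ finite_set (@extreme_points R k t x),
              forall (n : nat) (G : sgraph), (0 < n)%N -> F G ->
                num_vertices G = n ->
                (num_cliques G)%:R <= max_extreme t x (g t1) * n%:R
            & (C < t1)%N ->
              forall n : nat, 4 / 3 * t1%:R <= n%:R :> R ->
                exists G : sgraph, [/\ F G, num_vertices G = n
                  & max_extreme t x (- g t1) * n%:R
                      <= (num_cliques G)%:R]]].
Proof.
have [zf zP] := choice sixth_root.
(* The reduction to a dense set costs 849, and moving down to an extreme point three times
   the error 5 / 2 of the position below the lines; 857 exceeds the sum 849 + 15 / 2. *)
exists (fun m => (857 * zf m ^ 5)%:R), 1%N; split.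
- by move=> m; rewrite ler0n.
- exact: fifth_power_sublinear.
move=> F k Hs mF uF [Hmin Hall _] sorted t x t1.
have [z_gt0 _ tz] := zP t1; set z := zf t1 in z_gt0 tz *.
have z5 : (0 < z ^ 5)%N by rewrite expn_gt0 z_gt0.
split; first exact: finite_extreme_points.
- move=> n G n0 FG Gn.
  have nK : ~ F (complete_graph t1).
    by move=> FK; apply: (Hmin ord0).1; apply: (mF _ _ FK); exact: minor_complete_graph.
  have G0 : (0 < #|G|)%N by rewrite -/(num_vertices G) Gn.
  have [a [c [N [acN below bound]]]] := num_cliques_upper mF nK FG tz G0.
  have := sqr_bound_powR R bound.
  rewrite -/(num_vertices G) Gn; move/le_trans; apply.
  have acN' : 2 * a%:R + c%:R <= N%:R :> R by rewrite -natrM -natrD ler_nat.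
  have [||||p pE le] := @extreme_max R k t x _ (log2_3_bounds R) a%:R ((N + c)%:R / 2 - a%:R) ((5 * z ^ 5)%:R / 2).
  + by [].
  + by rewrite natrD; have := ler0n R c; lra.
  + by rewrite divr_ge0.
  + move=> i; have := below _ (Hmin i).1; rewrite -(ler_nat R) natrD natrM -/(num_vertices _) -/(t i) -/(x i).
    have := bent_line_of_nat R (t i) (x i) a; rewrite !natrD !natrM; lra.
  rewrite natrM [leRHS]mulrC -mulrA ler_pM2l ?ltr0n // -powR2_nat -powR2D.
  apply: le_trans (le_max_extreme _ pE); apply: powR2_le.
  have : (0 : R) <= (z ^ 5)%:R by [].
  rewrite !natrM; lra.
- move=> t1_gt1 n nt.
  have [p pE le] := max_extreme_attained t x (- (857 * z ^ 5)%:R : R).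
  have [[p1 p2E p2] _] := pE.
  have t_ge i : (t1 <= t i)%N by exact: sorted.
  have bl i : p.2 <= bent_line (t i) (x i) p.1 by rewrite p2E min_line_le.
  pose a' := (Num.trunc p.1).-1; pose b' := (Num.trunc p.2).-1.
  have below i : (3 * a' + 2 * b' + minn a' (x i) < 2 * t i)%N.
    by apply: rounding_below => //; apply: leq_trans (t_ge i); apply: ltnW.
  have nt' : (4 * t1 <= 3 * n)%N by rewrite -(ler_nat R) !natrM; lra.
  have mn : (2 * a' + b' <= n)%N by have := below ord0; rewrite -/t1; lia.
  have [|H mH|G [FG Gn bound]] := @num_cliques_lower F a' b' n mF uF _ _ mn.
  + move=> H /Hall [i /iso_card [-> _]]; exact: leq_trans t1_gt1 (t_ge i).
  + by have [i isoi] := Hall H mH; exists (Hs i) => //; exact: below.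
  exists G; split => //.
  apply: le_trans (ler_wpM2r (ler0n _ n) le) _.
  (* Rounding [a] and [b] costs a factor 36, and dividing the vertices into copies a
     factor 16 * z ^ 6. *)
  have bound' : (n * (3 ^ a' * 2 ^ b') <= 16 * z ^ 6 * num_cliques G)%N.
    apply: (leq_trans bound); rewrite leq_mul2r; apply/orP; right.
    by have := below ord0; rewrite -/t1; lia.
  have const : (36 * 16 * z ^ 6 <= 2 ^ (16 * z ^ 5))%N.
    have zle : (z <= z ^ 5)%N by rewrite -{1}(expn1 z) leq_pexp2l.
    apply: (@leq_trans (2 ^ 10 * 2 ^ (6 * z))%N).
      by apply: leq_mul => //; rewrite mulnC expnM leq_exp2r // ltnW // ltn_expl.
    by rewrite -expnD leq_exp2l //; lia.
  have round (r : R) : 0 <= r -> r <= ((Num.trunc r).-1 + 2)%:R.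
    move=> /truncn_itv /andP[_ lt]; apply/ltW/(lt_le_trans lt); rewrite ler_nat; lia.
  have val : 2 `^ (log2 3 * p.1 + p.2) <= (36 * (3 ^ a' * 2 ^ b'))%:R :> R.
    rewrite powR2D powR2_log2_3.
    have -> : (36 * (3 ^ a' * 2 ^ b') = 3 ^ (a' + 2) * 2 ^ (b' + 2))%N by rewrite !expnD; lia.
    rewrite natrM; apply: ler_pM; rewrite ?powR_ge0 //.
      by rewrite natrX -powR_mulrn //; apply: ler_powR; [rewrite ler1n|exact: round].
    by rewrite -powR2_nat; apply: powR2_le; exact: round.
  rewrite powR2D powRN -mulrA mulrCA mulrC ler_pdivrMr ?powR_gt0 //.
  apply: (@le_trans _ _ ((36 * (3 ^ a' * 2 ^ b'))%:R * n%:R)); first by rewrite ler_wpM2r.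
  rewrite powR2_nat -!natrM ler_nat.
  have const' : (36 * 16 * z ^ 6 <= 2 ^ (857 * z ^ 5))%N.
    by apply: (leq_trans const); rewrite leq_exp2l // leq_mul2r orbT.
  apply: (@leq_trans (36 * 16 * z ^ 6 * num_cliques G)%N).
    by rewrite -!mulnA leq_mul2l /= mulnC !mulnA -mulnA in bound' *; lia.
  by rewrite mulnC leq_mul2l const' orbT.
Qed.
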